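(* Let $(M,d,\mu)$ be a metric measure space satisfying the standing assumptions in the context, let $k$ be a Riesz-like kernel of order $\beta>1$ with normalization constants $A_0>0$, $A_\infty>0$ and constant $B\ge2^{1/\beta'}$, and let $Tf(x)=\int_Mk(x,y)f(y)\,d\mu(y)$. Let $f$ be a measurable function supported in a ball with $\|f\|_{\beta'}\le1$, and let $0<\tau<\mu(M)$. Then there is $z\in E_\tau$ such that for $0<t\le\tau$ we have $$(Tf)^*(t)\le(Tf)^{**}(t)\le Uf_\tau(t)+B\|f_\tau'\chi_{B_\tau(z)}\|_{\beta'}+(Tf)^\circ(\tau).$$
   Context: $(M,d,\mu)$ is a metric space with a Borel measure $\mu$. Let $B(x,r)=\{y: d(x,y)\le r\}$ and $V_x(r)=\mu(B(x,r))$. Standing assumptions: for all $x\in M$, $V_x(r)<\infty$ for all $r>0$, and $r\mapsto V_x(r)$ is continuous. $\beta'$ is the exponent conjugate to $\beta$, $\|\cdot\|_q$ is the norm of $L^q(M,\mu)$, $\chi_E$ is the characteristic function of $E$. A measurable $k:M\times M\to\mathbb{R}$ is a Riesz-like kernel of order $\beta>1$ with normalization constants $A_0,A_\infty$ if for some constant $B$: (K1) for all $x\in M$ and $0<V_x(r_1)<V_x(r_2)\le 1$: $\int_{r_1\le d(x,y)\le r_2}|k(x,y)|^\beta d\mu(y)\le A_0\log\frac{V_x(r_2)}{V_x(r_1)}+B$; (K2) for all $x\in M$ and $1\le V_x(r_1)<V_x(r_2)$: $\int_{r_1\le d(x,y)\le r_2}|k(x,y)|^\beta d\mu(y)\le A_\infty\log\frac{V_x(r_2)}{V_x(r_1)}+B$;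 (K3) for all $x,y\in M$: $|k(x,y)|\le B\,V_x(d(x,y))^{-1/\beta}$ and $|k(x,y)|\le B\,V_y(d(x,y))^{-1/\beta}$; (K4) for each $\delta>0$ there is $B_\delta>0$ such that for all $x\in M$: $\int_{d(x,y)>R}|k(x',y)-k(x,y)|^\beta d\mu(y)\le B_\delta$ whenever $V_x(R)\ge(1+\delta)V_x(r)$ and $x'\in B(x,r)$. For measurable $h$ with $m_h(s)=\mu(\{|h|>s\})<\infty$ for all $s>0$: $h^*(t)=\inf\{s\ge0:m_h(s)\le t\}$ and $h^{**}(t)=\frac1t\int_0^th^*(u)\,du$, $t>0$. Fix measurable level sets $F_\tau,E_\tau$ with $\mu(F_\tau)=\mu(E_\tau)=\tau$ and $$\{|f|>f^*(\tau)\}\subseteq F_\tau\subseteq\{|f|\ge f^*(\tau)\},\qquad \{|Tf|>(Tf)^*(\tau)\}\subseteq E_\tau\subseteq\{|Tf|\ge(Tf)^*(\tau)\}$$ (these exist under the standing assumptions). Put $f_\tau=f\chi_{F_\tau}$, $f_\tau'=f\chi_{F_\tau^c}$; $r_x(\tau)=\min\{r>0:V_x(r)=\tau\}$, $B_\tau(x)=B(x,r_x(\tau))$; and $$(Tf)^\circ(\tau)=\operatorname*{ess\,sup}_{x\in E_\tau}\big|T\big(f_\tau'\chi_{B_\tau(x)^c}\big)(x)\big|.$$ The O'Neil functional is $$Uh(t)=C_0t^{-1/\beta}\int_0^th^*(u)\,du+\int_t^\infty k_1^*(u)h^*(u)\,du,\qquad k_1^*(t)=\sup_{x\in M}(k(x,\cdot))^*(t),$$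 where $C_0$ is a suitable constant depending only on the kernel constants and $\beta$ (the constant of O'Neil's lemma, for which $(Th)^{**}\le Uh$); the lemma asserts the estimate for such a constant, independent of $f$, $\tau$ and $t$. *)

(* Defs.v *)
From HB Require Import structures.
From mathcomp Require Import all_boot all_order all_algebra.
From mathcomp Require Import all_classical all_reals all_analysis.

Set Implicit Arguments.
Unset Strict Implicit.
Unset Printing Implicit Defensive.

Import Order.TTheory GRing.Theory Num.Theory.
Import numFieldNormedType.Exports.

Local Open Scope classical_set_scope.
Local Open Scope ring_scope.
Local Open Scope ereal_scope.

HB.mixin Record isBorel (R : numDomainType) (d : measure_display) M
    & Metric R M & Measurable d M := {
  measurable_borel : (measurable : set (set M)) = <<s @open M >>
}.

#[short(type="borelMetricType")]
HB.structure Definition BorelMetric (R : numDomainType) (d : measure_display) :=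
  { M of Metric R M & Measurable d M & isBorel R d M }.

Section metric_measure_space.
Context (R : realType) (d : measure_display) (M : borelMetricType R d).
Variable mu : {measure set M -> \bar R}.
Implicit Types (x y : M) (r t tau : R) (f : M -> R) (h : M -> \bar R).

(* Not the library's closed_ball, which is the closure of the open ball. *)
Definition cball x r : set M := [set y | (mdist x y <= r)%R].

Definition vol x r : R := fine (mu (cball x r)).

Definition standing : Prop :=
  (forall x r, (0 < r)%R -> mu (cball x r) < +oo) /\
  (forall x, {within `[0%R, +oo[, continuous (vol x)}).

(* Under [standing], and whenever mu {x} < tau < mu M, this infimum is
   attained; here mu {x} = 0 unless M is reduced to a point. *)
Definition volradius x tau : R := inf [set r | (0 < r)%R /\ vol x r = tau].

Definition volball x tau : set M := cball x (volradius x tau).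

Definition distribution_fun h (s : R) : \bar R :=
  mu [set x | s%:E < `|h x|].

Definition rearr h t : \bar R :=
  ereal_inf [set s%:E | s in [set s : R | (0 <= s)%R /\
                                          distribution_fun h s <= t%:E]].

Definition rearr_avg h t : \bar R :=
  t^-1%:E * \int[lebesgue_measure]_(u in `]0%R, t[) rearr h u.

Definition level_set h tau (E : set M) : Prop :=
  [/\ measurable E, mu E = tau%:E,
      [set x | rearr h tau < `|h x|] `<=` E &
      E `<=` [set x | rearr h tau <= `|h x|]].

Definition ess_sup_on (E : set M) h : \bar R :=
  ereal_inf [set y | \forall x \ae mu, E x -> h x <= y].

Definition ball_supported f : Prop :=
  exists x r, forall y, ~ cball x r y -> f y = 0%R.

Section kernel.
Variables (beta : R) (k : M -> M -> R).

Definition riesz_like (A0 Ainf B : R) : Prop :=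
  [/\ measurable_fun [set: M * M] (fun p => k p.1 p.2),
      forall x r1 r2,
        (0 < vol x r1)%R -> (vol x r1 < vol x r2)%R -> (vol x r2 <= 1)%R ->
        \int[mu]_(y in [set y | r1 <= mdist x y <= r2]%R)
            (`|k x y| `^ beta)%:E
          <= (A0 * ln (vol x r2 / vol x r1) + B)%:E,
      forall x r1 r2,
        (1 <= vol x r1)%R -> (vol x r1 < vol x r2)%R ->
        \int[mu]_(y in [set y | r1 <= mdist x y <= r2]%R)
            (`|k x y| `^ beta)%:E
          <= (Ainf * ln (vol x r2 / vol x r1) + B)%:E,
      (* 0 `^ (- a) is 0 in the library, while the bound B V^(-1/beta) is
         infinite (hence void) when V = 0. *)
      forall x y,
        ((0 < vol x (mdist x y))%R ->
           (`|k x y| <= B * vol x (mdist x y) `^ (- beta^-1))%R) /\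
        ((0 < vol y (mdist x y))%R ->
           (`|k x y| <= B * vol y (mdist x y) `^ (- beta^-1))%R) &
      forall delta : R, (0 < delta)%R ->
        exists2 Bdelta : R, (0 < Bdelta)%R &
          forall x x' (r rr : R), (0 < r)%R -> (0 < rr)%R ->
            ((1 + delta) * vol x r <= vol x rr)%R -> cball x r x' ->
            \int[mu]_(y in [set y | rr < mdist x y]%R)
                (`|k x' y - k x y| `^ beta)%:E <= Bdelta%:E].

(* Extended-real valued: the integral need only converge for a.e. x. *)
Definition potential f x : \bar R := \int[mu]_y (k x y * f y)%:E.

Definition kernel_rearr t : \bar R :=
  ereal_sup [set rearr (EFin \o k x) t | x in [set: M]].

Definition oneil (C0 : R) f t : \bar R :=
  (C0 * t `^ (- beta^-1))%:E *
    \int[lebesgue_measure]_(u in `]0%R, t[) rearr (EFin \o f) u +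
  \int[lebesgue_measure]_(u in `]t, +oo[)
    (kernel_rearr u * rearr (EFin \o f) u).

Definition potential_circ f (F E : set M) tau : \bar R :=
  ess_sup_on E (fun x =>
    `| potential (fun y => f y * \1_(~` F) y * \1_(~` volball x tau) y)%R x |).

End kernel.
End metric_measure_space.

Definition conjugate_exponent (R : realType) (beta : R) : R :=
  fine (hoelder_conjugate beta%:E).

(* O'Neil's lemma with constant C0, uniformly over all spaces and all kernels
   with the given constants: C0 may depend on beta, A0, Ainf and B only. *)
Definition oneil_constant (R : realType) (beta A0 Ainf B C0 : R) : Prop :=
  forall (d : measure_display) (M : borelMetricType R d)
    (mu : {measure set M -> \bar R}) (k : M -> M -> R),
  standing mu -> riesz_like mu beta k A0 Ainf B ->
  forall h : M -> R, measurable_fun [set: M] h ->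
  (forall s : R, (0 < s)%R -> distribution_fun mu (EFin \o h) s < +oo) ->
  forall t : R, (0 < t)%R ->
  rearr_avg mu (potential mu k h) t <= oneil mu beta k C0 h t.

(* Main.v *)
Require Import Defs.
From HB Require Import structures.
From mathcomp Require Import all_boot all_order all_algebra.
From mathcomp Require Import all_classical all_reals all_analysis.
From mathcomp Require Import measurable_realfun ring.

(* Layer-cake integration gives the Hardy-Littlewood inequality
   [int |K G| <= int K^* G^*], and (K3) gives [k(x, .)^*(u), k(., y)^*(u) <=
   B u^(-1/beta)].

   Let [b] be the value at [t] of the rearrangement of the function under
   consideration, [phi] the part of its absolute value that enters O'Neil's
   functional, and [f1 = (phi - b)^+]. By duality against sets,
   [T_|k| f1] is of weak type: its rearrangement is at most
   [B beta' u^(-1/beta) ||f1||_1]. The rest of the function is bounded by [b], and by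
   Hardy-Littlewood it contributes pointwise at most
   [b int_0^t k_1^* + int_t^oo k_1^* phi^*] plus a tail. As
   [||f1||_1 + b t <= int_0^t phi^*], both inequalities follow with
   [C0 = B beta'^2].

   For the localized inequality [phi = |f| 1_F] and [b = f^*(t)], and the
   bounded part at [x] also contains [g = |f| 1_(F^c) 1_(B_tau(x))], which is
   at most [f^*(tau)] and lives on a set of measure at most [tau]. In the
   rearrangement it is pushed to [[tau, 2 tau]], so by Hoelder the tail is at
   most [B (int_tau^(2 tau) du/u)^(1/beta) ||g||_beta' = B (ln 2)^(1/beta)
   ||g||_beta']. Because [ln 2 < 1], one point [z] of [E] absorbs the supremum of
   these tails over [x] in [E]. *)

Set Implicit Arguments.
Unset Strict Implicit.
Unset Printing Implicit Defensive.

Import Order.TTheory GRing.Theory Num.Theory.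
Import numFieldNormedType.Exports.

Local Open Scope classical_set_scope.
Local Open Scope ring_scope.
Local Open Scope ereal_scope.

(** * Tonelli and the layer-cake formula *)

Section tonelli_sigma_finite.
Context (R : realType) (d1 d2 : measure_display)
  (T1 : measurableType d1) (T2 : measurableType d2).
Variables (m1 : {measure set T1 -> \bar R}) (m2 : {measure set T2 -> \bar R}).
Variable f : T1 * T2 -> \bar R.
Hypotheses (mf : measurable_fun setT f) (f0 : forall x, 0 <= f x).

Lemma measurable_integral2 : sigma_finite setT m2 ->
  measurable_fun setT (fun x => \int[m2]_y f (x, y)).
Proof.
move=> sf2.
(* [m2] is a bare measure, so its sigma-finiteness is packed into the structure on which Tonelli's
   theorem is stated. *)
pose n2 : {sigma_finite_measure set T2 -> \bar R} :=
  HB.pack_for (SigmaFiniteMeasure.type T2 R) (Measure.sort m2)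
    (isSFinite.Build _ _ _ _ (sfinite_measure_sigma_finite sf2))
    (isSigmaFinite.Build _ _ _ _ sf2).
exact: (measurable_fun_fubini_tonelli_F (m2 := n2) f mf f0).
Qed.

Lemma measurable_integral1 : sigma_finite setT m1 ->
  measurable_fun setT (fun y => \int[m1]_x f (x, y)).
Proof.
move=> sf1.
pose n1 : {sigma_finite_measure set T1 -> \bar R} :=
  HB.pack_for (SigmaFiniteMeasure.type T1 R) (Measure.sort m1)
    (isSFinite.Build _ _ _ _ (sfinite_measure_sigma_finite sf1))
    (isSigmaFinite.Build _ _ _ _ sf1).
exact: (measurable_fun_fubini_tonelli_G (m1 := n1) f mf f0).
Qed.

Lemma exchange_integral : sigma_finite setT m1 -> sigma_finite setT m2 ->
  \int[m1]_x \int[m2]_y f (x, y) = \int[m2]_y \int[m1]_x f (x, y).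
Proof.
move=> sf1 sf2.
pose n1 : {sigma_finite_measure set T1 -> \bar R} :=
  HB.pack_for (SigmaFiniteMeasure.type T1 R) (Measure.sort m1)
    (isSFinite.Build _ _ _ _ (sfinite_measure_sigma_finite sf1))
    (isSigmaFinite.Build _ _ _ _ sf1).
pose n2 : {sigma_finite_measure set T2 -> \bar R} :=
  HB.pack_for (SigmaFiniteMeasure.type T2 R) (Measure.sort m2)
    (isSFinite.Build _ _ _ _ (sfinite_measure_sigma_finite sf2))
    (isSigmaFinite.Build _ _ _ _ sf2).
exact: (fubini_tonelli (m1 := n1) (m2 := n2) f mf f0).
Qed.

End tonelli_sigma_finite.

Lemma sigma_finite_lebesgue (R : realType) :
  sigma_finite setT (@lebesgue_measure R).
Proof. exact: sigma_finiteT. Qed.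

(** Every superlevel set of a nonincreasing function is order-convex, hence an interval. *)
Lemma nonincreasing_emeasurable (R : realType) (D : set R) (f : R -> \bar R) :
  (forall x y, (x <= y)%R -> f y <= f x) -> measurable_fun D f.
Proof.
move=> fni; apply: (@measurable_funS _ _ _ _ setT) => //.
apply: (measurability (@ErealGenOInfty.G R)) => [|/= _ [_] [r] -> <-].
  exact: ErealGenOInfty.measurableE.
apply: measurableI => //; apply: is_interval_measurable => s t/=.
rewrite !in_itv/= !andbT => fs ft u /andP[su ut].
by rewrite in_itv/= andbT (lt_le_trans ft)// fni.
Qed.

Lemma indic_bool (R : realType) (T : Type) (b : T -> bool) (x : T) :
  \1_[set y | b y] x = (b x)%:R :> R.
Proof. by rewrite indicE; congr ((nat_of_bool _)%:R); apply/idP/idP; rewrite inE. Qed.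

Lemma measurable_bool_natr (R : realType) d (T : measurableType d) (b : T -> bool) :
  measurable_fun setT b -> measurable_fun setT (fun x => (b x)%:R%:E : \bar R).
Proof.
move=> mb; apply/measurable_EFinP.
apply: (eq_measurable_fun (\1_[set y | b y] : T -> R)) => [x _|].
  by rewrite indic_bool.
apply: measurable_indic; rewrite -[X in measurable X]setTI.
exact: (mb measurableT [set true]).
Qed.

Lemma integral_bool_natr (R : realType) d (T : measurableType d)
    (m : {measure set T -> \bar R}) (b : T -> bool) :
  measurable_fun setT b -> \int[m]_x (b x)%:R%:E = m [set x | b x].
Proof.
move=> mb; under eq_integral do rewrite -indic_bool.
rewrite integral_indic// ?setIT// -[X in measurable X]setTI.
exact: (mb measurableT [set true]).
Qed.

Section layer_cake.
Context (R : realType).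
Local Notation leb := (@lebesgue_measure R).

Section one_space.
Context (d : measure_display) (T : measurableType d).
Variables (m : {measure set T -> \bar R}) (w G : T -> \bar R).
Hypothesis sf : sigma_finite setT m.
Hypotheses (mw : measurable_fun setT w) (mG : measurable_fun setT G).
Hypotheses (w0 : forall x, 0 <= w x) (G0 : forall x, 0 <= G x).

Let f (p : T * measurableTypeR R) : \bar R :=
  w p.1 * ((0 <= p.2)%R && ((p.2 : R)%:E < G p.1)%E)%:R%:E.

Let mf : measurable_fun setT f.
Proof.
apply: emeasurable_funM; first exact: measurableT_comp.
apply: measurable_bool_natr; apply: measurable_and.
  exact: measurable_fun_ler.
apply: measurable_fun_lte; last exact: measurableT_comp.
by apply/measurable_EFinP; exact: measurable_snd.
Qed.

Let f0 p : 0 <= f p.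
Proof. by apply: mule_ge0 => //; rewrite lee_fin. Qed.

(** Tonelli for the region under the graph of [G], weighted by [w]: for fixed [x] the levels [r] in
    it form an interval of length [G x], infinite values included. The weight lets the formula be
    applied a second time, to [w] itself. *)
Lemma layer_cake : \int[m]_x (w x * G x) =
  \int[leb]_r \int[m]_x (w x * ((0 <= r)%R && ((r : R)%:E < G x)%E)%:R%:E).
Proof.
rewrite -(exchange_integral mf f0 sf (@sigma_finite_lebesgue R)).
apply: eq_integral => x _; rewrite /f/=.
have mb : measurable_fun (@setT (measurableTypeR R))
    (fun r => (0 <= r)%R && ((r : R)%:E < G x)).
  apply: measurable_and; first exact: measurable_fun_ler.
  by apply: measurable_fun_lte => //; exact/measurable_EFinP.
rewrite ge0_integralZl//; last first.
  exact: measurable_bool_natr.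
congr (_ * _); rewrite integral_bool_natr//.
have := G0 x; case: (G x) => [g|_|//].
- rewrite lee_fin => g0; transitivity (leb `[0%R, g[%classic).
    rewrite lebesgue_measure_itv/= lte_fin.
    by move: g0; rewrite le_eqVlt => /predU1P[<-|->]; rewrite ?ltxx ?sube0.
  by congr (leb _); apply/seteqP; split => r/=; rewrite in_itv/= lte_fin.
- transitivity (leb `[0%R, +oo[%classic); first by rewrite lebesgue_measure_itv/= ltry sube0.
  by congr (leb _); apply/seteqP; split => r/=; rewrite in_itv/= ltry.
Qed.

Lemma measurable_layer : measurable_fun (@setT (measurableTypeR R)) (fun r =>
  \int[m]_x (w x * ((0 <= r)%R && ((r : R)%:E < G x)%E)%:R%:E)).
Proof. exact: (measurable_integral1 mf f0 sf). Qed.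

End one_space.

Section two_spaces.
Context (d1 d2 : measure_display) (T1 : measurableType d1) (T2 : measurableType d2).
Variables (m1 : {measure set T1 -> \bar R}) (m2 : {measure set T2 -> \bar R}).
Hypotheses (sf1 : sigma_finite setT m1) (sf2 : sigma_finite setT m2).

Lemma le_integral_layer (w1 G1 : T1 -> \bar R) (w2 G2 : T2 -> \bar R) :
  measurable_fun setT w1 -> measurable_fun setT G1 ->
  measurable_fun setT w2 -> measurable_fun setT G2 ->
  (forall x, 0 <= w1 x) -> (forall x, 0 <= G1 x) ->
  (forall x, 0 <= w2 x) -> (forall x, 0 <= G2 x) ->
  (forall r : R, (0 <= r)%R ->
     \int[m1]_x (w1 x * (r%:E < G1 x)%E%:R%:E) <=
     \int[m2]_x (w2 x * (r%:E < G2 x)%E%:R%:E)) ->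
  \int[m1]_x (w1 x * G1 x) <= \int[m2]_x (w2 x * G2 x).
Proof.
move=> mw1 mG1 mw2 mG2 w10 G10 w20 G20 H.
rewrite (layer_cake sf1)// (layer_cake sf2)//.
apply: ge0_le_integral => //.
- move=> r _; apply: integral_ge0 => x _.
  by apply: mule_ge0 => //; rewrite lee_fin.
- exact: measurable_layer.
- exact: measurable_layer.
- move=> r _; have [r0|r0] := leP 0%R r; first exact: H.
  by rewrite !integral0_eq// => x _; rewrite mule0.
Qed.

(** Layer cake applied twice, first to [G] with weight [W], then to [W] with the indicator of
    [{G > r}] as weight: products are compared through the measures of intersections of superlevel
    sets. *)
Lemma le_integral_layer2 (W1 G1 : T1 -> \bar R) (W2 G2 : T2 -> \bar R) :
  measurable_fun setT W1 -> measurable_fun setT G1 ->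
  measurable_fun setT W2 -> measurable_fun setT G2 ->
  (forall x, 0 <= W1 x) -> (forall x, 0 <= G1 x) ->
  (forall x, 0 <= W2 x) -> (forall x, 0 <= G2 x) ->
  (forall r s : R, (0 <= r)%R -> (0 <= s)%R ->
     m1 [set x | (r%:E < G1 x) && (s%:E < W1 x)] <=
     m2 [set x | (r%:E < G2 x) && (s%:E < W2 x)]) ->
  \int[m1]_x (W1 x * G1 x) <= \int[m2]_x (W2 x * G2 x).
Proof.
move=> mW1 mG1 mW2 mG2 W10 G10 W20 G20 H.
apply: le_integral_layer => // r r0.
under eq_integral do rewrite muleC.
under [leRHS]eq_integral do rewrite muleC.
have mlt d' (T : measurableType d') (G : T -> \bar R) (t : R) :
    measurable_fun setT G -> measurable_fun setT (fun x => t%:E < G x).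
  by move=> mG; exact: measurable_fun_lte.
apply: le_integral_layer => //; try by [move=> ?; rewrite lee_fin |
  apply: measurable_bool_natr; exact: mlt].
move=> s s0; under eq_integral do rewrite -EFinM -natrM mulnb.
under [leRHS]eq_integral do rewrite -EFinM -natrM mulnb.
by rewrite !integral_bool_natr//; [exact: H|apply: measurable_and; exact: mlt..].
Qed.

End two_spaces.
End layer_cake.

(** * Decreasing rearrangement *)

Section rearrangement.
Context (R : realType) (d : measure_display) (M : borelMetricType R d).
Variable mu : {measure set M -> \bar R}.
Implicit Types (h : M -> \bar R) (s t u : R).
Local Notation leb := (@lebesgue_measure R).

Lemma measurable_superlevel h s : measurable_fun setT h ->
  measurable [set x | s%:E < `|h x|].
Proof.
move=> mh; rewrite -[X in measurable X]setTI.
by apply: emeasurable_fun_o_infty => //; exact: measurableT_comp.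
Qed.

Lemma distribution_fun_nonincreasing h s s' : measurable_fun setT h ->
  (s <= s')%R -> distribution_fun mu h s' <= distribution_fun mu h s.
Proof.
move=> mh ss'; apply: le_measure; rewrite ?inE; try exact: measurable_superlevel.
by move=> x/=; apply: le_lt_trans; rewrite lee_fin.
Qed.

Lemma le_distribution_fun h h' s : measurable_fun setT h ->
  measurable_fun setT h' -> (forall x, `|h x| <= `|h' x|) ->
  distribution_fun mu h s <= distribution_fun mu h' s.
Proof.
move=> mh mh' hh'; apply: le_measure; rewrite ?inE; try exact: measurable_superlevel.
by move=> x/= /lt_le_trans; exact.
Qed.

Lemma rearr_ge0 h t : 0 <= rearr mu h t.
Proof. by apply: le_ereal_inf_tmp => _ [s [s0 _] <-]; rewrite lee_fin. Qed.

Lemma rearr_nonincreasing h t t' : (t <= t')%R -> rearr mu h t' <= rearr mu h t.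
Proof.
move=> tt'; apply: le_ereal_inf => _ [s [s0 hs] <-]; exists s => //; split => //.
by rewrite (le_trans hs)// lee_fin.
Qed.

Lemma rearr_le_rearr h h' t t' :
  (forall s, (0 <= s)%R -> distribution_fun mu h' s <= t'%:E ->
     distribution_fun mu h s <= t%:E) ->
  rearr mu h t <= rearr mu h' t'.
Proof.
move=> H; apply: le_ereal_inf => _ [s [s0 hs] <-]; exists s => //.
by split => //; exact: H.
Qed.

Lemma le_rearr h h' t : measurable_fun setT h ->
  measurable_fun setT h' -> (forall x, `|h x| <= `|h' x|) ->
  rearr mu h t <= rearr mu h' t.
Proof.
move=> mh mh' hh'; apply: rearr_le_rearr => s s0; apply: le_trans.
exact: le_distribution_fun.
Qed.

Lemma measurable_rearr h (D : set R) : measurable_fun D (rearr mu h).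
Proof. by apply: nonincreasing_emeasurable => x y; exact: rearr_nonincreasing. Qed.

(* The infimum defining [rearr] is attained, because the distribution
   function is right-continuous. *)
Lemma rearr_le h s t : measurable_fun setT h -> (0 <= s)%R ->
  (rearr mu h t <= s%:E) = (distribution_fun mu h s <= t%:E).
Proof.
move=> mh s0; apply/idP/idP => [hs|hs]; last first.
  by apply: ereal_inf_lbound; exists s.
have sn n : distribution_fun mu h (s + n.+1%:R^-1)%R <= t%:E.
  have : rearr mu h t < (s + n.+1%:R^-1)%:E.
    by rewrite (le_lt_trans hs)// lte_fin ltrDl.
  move=> /ereal_inf_lt[_ [s' [s'0 hs'] <-]]; rewrite lte_fin => s's.
  by apply: le_trans hs'; apply: distribution_fun_nonincreasing => //; exact: ltW.
pose F n := [set x | (s + n.+1%:R^-1)%:E < `|h x|].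
have FE : [set x | s%:E < `|h x|] = \bigcup_n F n.
  apply/seteqP; split => [x/= sx|x [n _]/=]; last first.
    by apply: le_lt_trans; rewrite lee_fin lerDl.
  have [hx|hx] := eqVneq `|h x| +oo.
    by exists 0%N => //; rewrite /F/= hx ltry.
  have hf : `|h x| \is a fin_num by rewrite ge0_fin_numE// ltey.
  move: sx; rewrite -(fineK hf) lte_fin => sx.
  have [n _ /(_ _ (leqnn n)) /= nx] := near_infty_natSinv_lt (PosNum (etrans (subr_gt0 _ _) sx)).
  by exists n => //; rewrite /F/= -(fineK hf) lte_fin addrC -ltrBrDr.
have mF n : measurable (F n) by exact: measurable_superlevel.
have cF : (mu \o F) n @[n --> \oo] --> mu (\bigcup_n F n).
  apply: nondecreasing_cvg_mu => //; first exact: bigcup_measurable.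
  move=> n m nm; apply/subsetPset => x/=; apply: le_lt_trans.
  by rewrite lee_fin lerD2l lef_pV2 ?posrE// ler_nat.
rewrite /distribution_fun FE -(cvg_lim _ cF)//; apply: lime_le.
  by apply/cvg_ex; eexists; exact: cF.
by apply: nearW => n; exact: sn.
Qed.

Lemma rearr_gt h s t : measurable_fun setT h -> (0 <= s)%R ->
  (s%:E < rearr mu h t) = (t%:E < distribution_fun mu h s).
Proof. by move=> mh s0; rewrite !ltNge rearr_le. Qed.

Lemma le_rearr_cst h s t : (0 <= s)%R -> (0 <= t)%R -> (forall x, `|h x| <= s%:E) ->
  rearr mu h t <= s%:E.
Proof.
move=> s0 t0 hs; apply: ereal_inf_lbound; exists s => //; split => //.
rewrite /distribution_fun (_ : [set x | _] = set0) ?measure0//.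
by apply/seteqP; split => // x/=; rewrite ltNge hs.
Qed.

Lemma lebesgue_measure_lt (a : \bar R) : 0 <= a ->
  leb [set u : R | (0 < u)%R && (u%:E < a)] = a.
Proof.
case: a => [a|_|//].
- rewrite lee_fin => a0; transitivity (leb `]0%R, a[%classic).
    by congr (leb _); apply/seteqP; split => r/=; rewrite in_itv/= lte_fin.
  rewrite lebesgue_measure_itv/= lte_fin.
  by move: a0; rewrite le_eqVlt => /predU1P[<-|->]; rewrite ?ltxx ?sube0.
- transitivity (leb `]0%R, +oo[%classic); last first.
    by rewrite lebesgue_measure_itv/= ltry sube0.
  by congr (leb _); apply/seteqP; split => r/=; rewrite in_itv/= ltry.
Qed.

Lemma hardy_littlewood (K G : M -> \bar R) : sigma_finite setT mu ->
  measurable_fun setT K -> measurable_fun setT G ->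
  \int[mu]_x (`|K x| * `|G x|) <=
  \int[leb]_(u in `]0%R, +oo[) (rearr mu K u * rearr mu G u).
Proof.
move=> sf mK mG; pose D : set R := `]0%R, +oo[%classic.
(* The restriction to [u > 0] goes onto one factor, since [rearr] is [+oo] at negative arguments and
   the layer-cake comparison runs over the whole line. *)
have -> : \int[leb]_(u in D) (rearr mu K u * rearr mu G u) =
    \int[leb]_u ((rearr mu K \_ D) u * rearr mu G u).
  rewrite integral_mkcond; apply: eq_integral => u _; rewrite !patchE.
  by case: ifP => //; rewrite mul0e.
have mD : measurable D by exact: measurable_itv.
have mrK : measurable_fun (@setT (measurableTypeR R)) (rearr mu K \_ D).
  by apply: (measurable_restrictT _ mD).1; exact: measurable_rearr.
have mrG : measurable_fun (@setT (measurableTypeR R)) (rearr mu G).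
  exact: measurable_rearr.
have rK0 u : 0 <= (rearr mu K \_ D) u.
  by apply: erestrict_ge0 => ? _; exact: rearr_ge0.
apply: (le_integral_layer2 sf (@sigma_finite_lebesgue R)) => //; try exact: measurableT_comp.
  by move=> u; exact: rearr_ge0.
move=> r s r0 s0; set a := leLHS.
have mA : measurable [set x | (r%:E < `|G x|) && (s%:E < `|K x|)].
  rewrite (_ : mkset _ = [set x | r%:E < `|G x|] `&` [set x | s%:E < `|K x|]).
    by apply: measurableI; exact: measurable_superlevel.
  by apply/seteqP; split => x/= /andP.
have aG : a <= distribution_fun mu G r.
  apply: le_measure; rewrite ?inE//; first exact: measurable_superlevel.
  by move=> x/= /andP[].
have aK : a <= distribution_fun mu K s.
  apply: le_measure; rewrite ?inE//; first exact: measurable_superlevel.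
  by move=> x/= /andP[].
have a0 : 0 <= a by exact: measure_ge0.
(* The measure [a] of the intersection is the length of []0, a[], and every [u] in that interval
   lies in the superlevel sets of both rearrangements. *)
rewrite -(lebesgue_measure_lt a0).
have mlt (g : R -> \bar R) (t : R) : measurable_fun (@setT (measurableTypeR R)) g ->
    measurable [set u | t%:E < g u].
  move=> mg; rewrite -[X in measurable X]setTI; exact: emeasurable_fun_o_infty.
apply: le_measure; rewrite ?inE.
- rewrite (_ : mkset _ = `]0%R, +oo[ `&` [set u : R | u%:E < a]).
    apply: measurableI => //; rewrite -[X in measurable X]setTI.
    apply: emeasurable_fun_infty_o => //; exact/measurable_EFinP.
  by apply/seteqP; split => x/=; rewrite in_itv/= andbT => /andP.
- rewrite (_ : mkset _ = [set u | r%:E < rearr mu G u] `&`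
      [set u | s%:E < (rearr mu K \_ D) u]).
    by apply: measurableI; exact: mlt.
  by apply/seteqP; split => x/= /andP.
- move=> u /= /andP[u0 ua].
  rewrite rearr_gt// (lt_le_trans ua)//= patchE mem_set/=.
    by rewrite rearr_gt// (lt_le_trans ua).
  by rewrite /D/= in_itv/= u0.
Qed.

End rearrangement.

(** * Balls, their volumes and the weak-type bound for kernels *)

Section volume.
Context (R : realType) (d : measure_display) (M : borelMetricType R d).
Variable mu : {measure set M -> \bar R}.
Implicit Types (x y : M) (r s t u v : R).

Lemma measurable_cball x r : measurable (cball x r).
Proof.
rewrite -[X in measurable X]setCK; apply: measurableC.
rewrite measurable_borel; apply: sub_sigma_algebra; rewrite openE => y/= /negP.
rewrite -ltNge => xy; apply/nbhs_ballP; exists (mdist x y - r)%R => /=.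
  by rewrite subr_gt0.
move=> z; rewrite ballEmdist/= ltrBrDr => yz; apply/negP; rewrite -ltNge.
rewrite -(ltrD2l (mdist y z)) (lt_le_trans yz)// addrC metric_sym.
by rewrite (metric_sym y z) -(metric_sym x) metric_triangle.
Qed.

Lemma subset_cball x r r' : (r <= r')%R -> cball x r `<=` cball x r'.
Proof. by move=> rr' y/= /le_trans; exact. Qed.

Hypothesis st : standing mu.

Lemma cball_lty x r : mu (cball x r) < +oo.
Proof.
apply: (@le_lt_trans _ _ (mu (cball x (`|r| + 1)%R))); last first.
  by apply: st.1; rewrite ltr_wpDl.
apply: le_measure; rewrite ?inE; try exact: measurable_cball.
by apply: subset_cball; rewrite (le_trans (ler_norm r))// lerDl.
Qed.

Lemma volE x r : (vol mu x r)%:E = mu (cball x r).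
Proof. by rewrite fineK// ge0_fin_numE// cball_lty. Qed.

Lemma vol_ge0 x r : (0 <= vol mu x r)%R.
Proof. by rewrite -lee_fin volE. Qed.

Lemma bigcup_cball x : \bigcup_n cball x n%:R = setT.
Proof.
apply/seteqP; split => // y _; exists (Num.bound (mdist x y)) => //=.
by apply/ltW/archi_boundP; exact: mdist_ge0.
Qed.

Lemma sigma_finite_standing : sigma_finite setT mu.
Proof.
exists (fun n => cball (point : M) n%:R); first by rewrite bigcup_cball.
by move=> n; split; [exact: measurable_cball|exact: cball_lty].
Qed.

(** Balls of integer radius about a fixed point exhaust the space, so continuity from below reduces
    a bound on [mu A] to pieces of finite measure. *)
Lemma measure_le_bounded (A : set M) (c : \bar R) : measurable A ->
  (forall n, mu (A `&` cball (point : M) n%:R) <= c) -> mu A <= c.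
Proof.
move=> mA Ac; have mF n : measurable (A `&` cball (point : M) n%:R).
  by apply: measurableI => //; exact: measurable_cball.
have AE : A = \bigcup_n (A `&` cball (point : M) n%:R).
  by rewrite -setI_bigcupr bigcup_cball setIT.
have cF : mu (A `&` cball (point : M) n%:R) @[n --> \oo] -->
    mu (\bigcup_n (A `&` cball (point : M) n%:R)).
  apply: (@nondecreasing_cvg_mu _ _ _ mu
    (fun n => A `&` cball (point : M) n%:R)) => //; first exact: bigcup_measurable.
  move=> n m nm; apply/subsetPset; apply: setIS; apply: subset_cball.
  by rewrite ler_nat.
rewrite AE -(cvg_lim _ cF)//; apply: lime_le.
  by apply/cvg_ex; eexists; exact: cF.
by apply: nearW => n; exact: Ac.
Qed.

(** [A] lies in the ball of radius [rho], the supremum of the radii of volume below [v], and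
    continuity of the volume gives [vol mu x rho <= v]. *)
Lemma measure_vol_lt (A : set M) x v : measurable A -> (0 < v)%R ->
  A `<=` [set y | (vol mu x (mdist x y) < v)%R] -> mu A <= v%:E.
Proof.
move=> mA v0 Av; pose S := [set r | (0 <= r)%R /\ (vol mu x r < v)%R].
have [A0|/set0P[y0 Ay0]] := eqVneq A set0.
  by rewrite A0 measure0 lee_fin ltW.
have S0 : S !=set0 by exists (mdist x y0); split; [exact: mdist_ge0|exact: Av].
(* If these radii are unbounded, each bounded piece of [A] already lies in a ball of volume less
   than [v]. *)
have [Sub|/has_ubPn Sub] := pselect (has_ubound S); last first.
  apply: measure_le_bounded => // n.
  have [r [r0 rv] nr] := Sub (mdist x (point : M) + n%:R)%R.
  apply: (@le_trans _ _ (mu (cball x r))); last by rewrite -volE lee_fin ltW.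
  apply: le_measure; rewrite ?inE; try exact: measurable_cball.
    by apply: measurableI => //; exact: measurable_cball.
  move=> y [_/= yn]; rewrite /cball/= (le_trans (metric_triangle x point y))//.
  by rewrite (le_trans _ (ltW nr))// lerD2l.
set rho := sup S.
have rho0 : (0 <= rho)%R.
  case: S0 => r Sr; apply: (le_trans Sr.1); exact: ub_le_sup.
apply: (@le_trans _ _ (mu (cball x rho))).
  apply: le_measure; rewrite ?inE//; first exact: measurable_cball.
  move=> y Ay; rewrite /cball/=; apply: ub_le_sup => //.
  by split; [exact: mdist_ge0|exact: Av].
rewrite -volE lee_fin leNgt; apply/negP => vrho.
(* If the volume at [rho] exceeded [v], it would do so at all nearby nonnegative radii, and elements
   of [S] come arbitrarily close to [rho]. *)
have /subspace_continuousP /(_ rho) := st.2 x.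
rewrite /= in_itv/= rho0 => /(_ isT) /cvgr_gt /(_ _ vrho).
rewrite /prop_near1 nbhs_simpl/= => /nbhs_ballP[e /= e0 He].
have [r [r0 rv] rrho] := sup_adherent e0 (conj S0 Sub).
have rr : (r <= rho)%R by exact: ub_le_sup.
have := He r; rewrite /ball/= in_itv/= r0 ger0_norm ?subr_ge0//.
move=> /(_ _ isT) H; suff : (v < vol mu x r)%R by rewrite ltNge (ltW rv).
by apply: H; rewrite ltrBlDl -ltrBlDr.
Qed.

(** Where [|kap y| > s], the bound forces the volume to be below [(B / s)^beta]; where the volume is
    0 the bound says nothing, but 0 is below that positive number anyway. So the superlevel set
    falls under [measure_vol_lt]. *)
Lemma weak_kernel_distribution (beta B : R) (kap : M -> R) x s :
  (0 < beta)%R -> (0 < B)%R -> (0 < s)%R -> measurable_fun setT kap ->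
  (forall y, (0 < vol mu x (mdist x y))%R ->
    (`|kap y| <= B * vol mu x (mdist x y) `^ (- beta^-1))%R) ->
  distribution_fun mu (EFin \o kap) s <= ((B / s) `^ beta)%:E.
Proof.
move=> beta0 B0 s0 mk Hk; apply: (@measure_vol_lt _ x).
- by apply: measurable_superlevel; exact/measurable_EFinP.
- by rewrite powR_gt0// divr_gt0.
move=> y/=; rewrite lte_fin => sk.
have := vol_ge0 x (mdist x y); rewrite le_eqVlt => /predU1P[<-|v0].
  by rewrite powR_gt0// divr_gt0.
have := lt_le_trans sk (Hk y v0); set V := vol mu x (mdist x y) in v0 *.
rewrite powRN ltr_pdivlMr ?powR_gt0// mulrC -ltr_pdivlMr// => VB.
have -> : V = ((V `^ beta^-1) `^ beta)%R.
  by rewrite -powRrM mulVf ?powRr1 ?(ltW v0)// gt_eqF.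
by apply: gt0_ltr_powR => //; rewrite nnegrE ?powR_ge0// divr_ge0 ?ltW.
Qed.

Lemma weak_rearr (beta B : R) (h : M -> \bar R) u :
  (0 < beta)%R -> (0 < B)%R -> (0 < u)%R -> measurable_fun setT h ->
  (forall s, (0 < s)%R -> distribution_fun mu h s <= ((B / s) `^ beta)%:E) ->
  rearr mu h u <= (B * u `^ (- beta^-1))%:E.
Proof.
move=> beta0 B0 u0 mh Hd; set s := (B * _)%R.
have s0 : (0 < s)%R by rewrite mulr_gt0// powR_gt0.
rewrite rearr_le ?(ltW s0)// (le_trans (Hd _ s0))// lee_fin.
rewrite /s powRN invfM invrK mulrA divff ?gt_eqF// mul1r.
by rewrite -powRrM mulVf ?powRr1 ?(ltW u0)// gt_eqF.
Qed.

End volume.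

(** * Weak-type estimates for the kernel *)

Section real_integrals.
Context (R : realType).
Local Notation leb := (@lebesgue_measure R).
Implicit Types (f F : R -> R) (a b t beta : R).

Lemma conjugate_exponent_gt1 beta : (1 < beta)%R -> (1 < conjugate_exponent beta)%R.
Proof.
move=> b1; have b10 : (0 < beta - 1)%R by rewrite subr_gt0.
rewrite /conjugate_exponent /hoelder_conjugate/= gt_eqF ?lte_fin ?(lt_trans ltr01)//=.
rewrite inver gt_eqF// -EFinM/= ltr_pdivlMr// mul1r.
by rewrite ltrBlDr ltrDl.
Qed.

Lemma conjugate_exponentP beta : (1 < beta)%R ->
  (beta^-1 + (conjugate_exponent beta)^-1 = 1)%R.
Proof.
move=> b1; have b10 : (0 < beta - 1)%R by rewrite subr_gt0.
rewrite /conjugate_exponent /hoelder_conjugate/= gt_eqF ?lte_fin ?(lt_trans ltr01)//=.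
rewrite inver gt_eqF// -EFinM/= invfM invrK.
by field; rewrite gt_eqF// (lt_trans ltr01).
Qed.

Lemma ftc_pos f F a b : (0 < a)%R -> (a < b)%R ->
  (forall x : R, (0 < x)%R -> is_derive x 1%R F (f x)) ->
  (forall x : R, (0 < x)%R -> {for x, continuous f}) ->
  \int[leb]_(x in `[a, b]) (f x)%:E = (F b - F a)%:E.
Proof.
move=> a0 ab dF cf; rewrite EFinB; apply: continuous_FTC2 => //.
- apply: continuous_in_subspaceT => x; rewrite inE/= in_itv/= => /andP[ax _].
  by apply: cf; exact: lt_le_trans ax.
- have cF x : (0 < x)%R -> {for x, continuous F}.
    move=> x0; apply/differentiable_continuous/derivable1_diffP.
    by apply: ex_derive; exact: dF.
  split.
  + move=> x; rewrite in_itv/= => /andP[ax _].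
    by apply: ex_derive; apply: dF; exact: lt_trans ax.
  + by apply: cvg_at_right_filter; exact: cF.
  + by apply: cvg_at_left_filter; apply: cF; exact: lt_trans ab.
- move=> x; rewrite in_itv/= => /andP[ax _]; rewrite derive1E.
  by apply: derive_val; apply: dF; exact: lt_trans ax.
Qed.

Lemma continuous_powRl a (x : R) : (0 < x)%R ->
  {for x, continuous (fun u : R => u `^ a)%R}.
Proof.
move=> x0; apply/differentiable_continuous/derivable1_diffP.
by apply: derivable_powR; rewrite in_itv/= x0.
Qed.

(** [q u^(1/q)] is an antiderivative because [1/q - 1 = -1/beta]. The integrand is singular at 0, so
    the integral is the limit of those over intervals starting at [1/(n+1)]. *)
Lemma integral_powR_conjugate beta t : (1 < beta)%R -> (0 < t)%R ->
  \int[leb]_(u in `]0%R, t[) (u `^ (- beta^-1))%:E <=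
  (conjugate_exponent beta * t `^ (conjugate_exponent beta)^-1)%:E.
Proof.
move=> b1 t0; set q := conjugate_exponent beta.
have q0 : (0 < q)%R by apply: lt_trans (conjugate_exponent_gt1 b1).
have bq : (q^-1 - 1 = - beta^-1)%R.
  by rewrite -(conjugate_exponentP b1) opprD addrCA subrr addr0.
have mf (D : set R) : measurable D -> measurable_fun D (fun u : R => (u `^ (- beta^-1))%:E).
  by move=> mD; apply/measurable_EFinP; apply: measurable_funTS; exact: measurable_powR.
rewrite itv_open_bnd_bigcup; set F := fun n : nat => _.
have cF : \int[leb]_(x in F n) (x `^ (- beta^-1))%:E @[n --> \oo] -->
    \int[leb]_(x in \bigcup_n F n) (x `^ (- beta^-1))%:E.
  apply: ge0_nondecreasing_set_cvg_integral => //.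
  - move=> n m nm; apply/subsetPset => x; rewrite /F/= !in_itv/= !add0r => /andP[nx ->].
    by rewrite andbT (le_trans _ nx)// lef_pV2 ?posrE// ler_nat.
  - by move=> n; exact: measurable_itv.
  - by move=> n; apply: mf; exact: measurable_itv.
  - by move=> n x _; rewrite lee_fin powR_ge0.
rewrite -(cvg_lim _ cF)//; apply: lime_le; first by apply/cvg_ex; eexists; exact: cF.
apply: nearW => n; rewrite /F add0r; set e := (n.+1%:R^-1)%R.
have e0 : (0 < e)%R by rewrite invr_gt0.
have [te|et] := leP t e.
  rewrite set_itv_ge ?integral_set0; first by rewrite lee_fin mulr_ge0 ?powR_ge0// ltW.
  by rewrite bnd_simp -leNgt.
apply: (@le_trans _ _ (\int[leb]_(x in `[e, t]) (x `^ (- beta^-1))%:E)).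
  apply: ge0_subset_integral => //.
  - by apply: mf; exact: measurable_itv.
  - by move=> x _; rewrite lee_fin powR_ge0.
  - by apply: subset_itvl; rewrite bnd_simp.
have dF (x : R) : (0 < x)%R -> is_derive x 1%R (fun u => q * u `^ q^-1)%R (x `^ (- beta^-1))%R.
  move=> x0; have -> : (x `^ (- beta^-1) = q *: (q^-1 * x `^ (q^-1 - 1)))%R.
    by rewrite bq /GRing.scale/= mulrA divff ?mul1r// gt_eqF.
  apply: is_deriveZ; exact: is_derive1_powR.
rewrite (ftc_pos e0 et dF (@continuous_powRl _)).
by rewrite lee_fin lerBlDr lerDl mulr_ge0 ?powR_ge0// ltW.
Qed.

Lemma integral_invr_doubling t : (0 < t)%R ->
  \int[leb]_(u in `[t, (2 * t)%R]) (u^-1)%:E = (ln 2)%:E.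
Proof.
move=> t0; rewrite (@ftc_pos _ (@ln R))//.
- by rewrite lnM ?posrE// addrK.
- by rewrite ltr_pMl// ltr1n.
- by move=> x x0; apply: inv_continuous; rewrite gt_eqF.
Qed.

Lemma ln2_lt1 : (ln 2 < 1 :> R)%R.
Proof.
rewrite -[X in (_ < X)%R]expRK ltr_ln ?posrE ?expR_gt0//.
by rewrite (_ : 2%R = (1 + 1)%R)// expR_gt1Dx.
Qed.

Lemma ge0_integral_itv0y_split (g : R -> \bar R) t : (0 < t)%R ->
  measurable_fun (`]0%R, +oo[%classic : set R) g -> (forall u, (0 < u)%R -> 0 <= g u) ->
  \int[leb]_(u in `]0%R, +oo[) g u =
  \int[leb]_(u in `]0%R, t[) g u + \int[leb]_(u in `]t, +oo[) g u.
Proof.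
move=> t0 mg g0; rewrite (integral_itv_obnd_cbnd (r := t)); last first.
  apply: measurable_funS mg => //; apply: subset_itvr; rewrite bnd_simp; exact: ltW.
have e : `]0%R, +oo[%classic = `]0%R, t[ `|` `[t, +oo[ :> set R.
  by rewrite -itv_bndbnd_setU// bnd_simp.
rewrite e ge0_integral_setU//.
- by rewrite -e.
- by rewrite -e => x/=; rewrite in_itv/= andbT; exact: g0.
- apply/disj_setPRL => x/=; rewrite !in_itv/= andbT => tx.
  by apply/negP; rewrite [X in _ && X]ltNge tx andbF.
Qed.

End real_integrals.

Lemma integral_indic_mul (R : realType) d (T : measurableType d)
    (m : {measure set T -> \bar R}) (A : set T) (g : T -> \bar R) :
  \int[m]_(x in A) g x = \int[m]_x ((\1_A x)%:E * g x).
Proof.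
rewrite integral_mkcond; apply: eq_integral => x _; rewrite patchE indicE.
by case: (x \in A); rewrite ?mul1e ?mul0e.
Qed.

(** * Potentials with kernel [|k|] and averages of rearrangements *)

Section oneil_core.
Context (R : realType) (d : measure_display) (M : borelMetricType R d).
Variable mu : {measure set M -> \bar R}.
Variables (beta A0 Ainf B : R) (k : M -> M -> R).
Hypotheses (beta1 : (1 < beta)%R) (B0 : (0 < B)%R).
Hypotheses (st : standing mu) (rk : riesz_like mu beta k A0 Ainf B).
Local Notation leb := (@lebesgue_measure R).
Local Notation q := (conjugate_exponent beta).
Implicit Types (x y : M) (s t u b : R).

Let beta0 : (0 < beta)%R. Proof. exact: lt_trans beta1. Qed.
Let q0 : (0 < q)%R. Proof. exact: lt_trans (conjugate_exponent_gt1 beta1). Qed.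
Let sf : sigma_finite setT mu. Proof. exact: sigma_finite_standing. Qed.

Lemma measurable_kernel : measurable_fun setT (fun p : M * M => k p.1 p.2).
Proof. by case: rk. Qed.

Lemma measurable_kernel_row x : measurable_fun setT (k x).
Proof. exact: (measurable_fun_pair2 x measurable_kernel). Qed.

Lemma measurable_kernel_col y : measurable_fun setT (k^~ y).
Proof. exact: (measurable_fun_pair1 y measurable_kernel). Qed.

Lemma rearr_kernel_row x u : (0 < u)%R ->
  rearr mu (EFin \o k x) u <= (B * u `^ (- beta^-1))%:E.
Proof.
move=> u0; apply: weak_rearr => //.
  exact/measurable_EFinP/measurable_kernel_row.
move=> s s0; apply: (@weak_kernel_distribution _ _ _ _ st beta B (k x) x) => //.
  exact: measurable_kernel_row.
by move=> y vy; case: rk => _ _ _ /(_ x y)[+ _] _; exact.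
Qed.

Lemma rearr_kernel_col y u : (0 < u)%R ->
  rearr mu (EFin \o k^~ y) u <= (B * u `^ (- beta^-1))%:E.
Proof.
move=> u0; apply: weak_rearr => //.
  exact/measurable_EFinP/measurable_kernel_col.
move=> s s0; apply: (@weak_kernel_distribution _ _ _ _ st beta B (k^~ y) y) => //.
  exact: measurable_kernel_col.
move=> x; rewrite (metric_sym y) => vy.
by case: rk => _ _ _ /(_ x y)[_ +] _; exact.
Qed.

Lemma rearr_le_kernel_rearr x u : rearr mu (EFin \o k x) u <= kernel_rearr mu k u.
Proof. by apply: ereal_sup_ubound; exists x. Qed.

Lemma kernel_rearr_ge0 u : 0 <= kernel_rearr mu k u.
Proof. exact: le_trans (rearr_ge0 _ _ _) (rearr_le_kernel_rearr point u). Qed.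

Lemma kernel_rearr_le u : (0 < u)%R ->
  kernel_rearr mu k u <= (B * u `^ (- beta^-1))%:E.
Proof.
by move=> u0; apply: ge_ereal_sup => _ [x _ <-]; exact: rearr_kernel_row.
Qed.

Lemma measurable_kernel_rearr (D : set R) : measurable_fun D (kernel_rearr mu k).
Proof.
apply: nonincreasing_emeasurable => u v uv; apply: ge_ereal_sup => _ [x _ <-].
exact: le_trans (rearr_nonincreasing _ _ uv) (rearr_le_kernel_rearr x u).
Qed.

(** Hardy-Littlewood against the indicator of [A], whose rearrangement is at most 1 and vanishes
    beyond [t], leaves the integral over []0, t[] of the bound [B u^(-1/beta)] for columns of the
    kernel. *)
Lemma integral_kernel_col (A : set M) y t : measurable A -> (0 < t)%R ->
  mu A <= t%:E -> \int[mu]_(x in A) `|k x y|%:E <= (B * q * t `^ q^-1)%:E.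
Proof.
move=> mA t0 At; have mI : measurable_fun setT (EFin \o (\1_A : M -> R)).
  exact/measurable_EFinP/measurable_indic.
have I1 x : `|(EFin \o (\1_A : M -> R)) x| = (\1_A x)%:E.
  by rewrite /= ger0_norm.
have -> : \int[mu]_(x in A) `|k x y|%:E =
    \int[mu]_x (`|(EFin \o k^~ y) x| * `|(EFin \o (\1_A : M -> R)) x|).
  by rewrite integral_indic_mul; apply: eq_integral => x _; rewrite I1 muleC.
apply: (le_trans (hardy_littlewood sf _ mI)).
  exact/measurable_EFinP/measurable_kernel_col.
have mprod (D : set R) : measurable_fun D
    (fun u => rearr mu (EFin \o k^~ y) u * rearr mu (EFin \o (\1_A : M -> R)) u).
  by apply: emeasurable_funM; exact: measurable_rearr.
rewrite (ge0_integral_itv0y_split t0)//; last first.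
  by move=> u _; rewrite mule_ge0// rearr_ge0.
rewrite [X in _ + X]integral0_eq ?adde0; last first.
  move=> u/=; rewrite in_itv/= andbT => tu.
  rewrite [X in _ * X](_ : _ = 0) ?mule0//; apply/eqP; rewrite eq_le rearr_ge0 andbT.
  apply: ereal_inf_lbound; exists 0%R => //; split => //.
  rewrite (@le_trans _ _ t%:E) ?lee_fin ?(ltW tu)// (le_trans _ At)//.
  apply: le_measure; rewrite ?inE//; first exact: measurable_superlevel.
  by move=> x/=; rewrite indicE; case: (boolP (x \in A)); rewrite ?normr0 ?ltxx// inE.
apply: (@le_trans _ _ (\int[leb]_(u in `]0%R, t[) (B%:E * (u `^ (- beta^-1))%:E))).
  apply: ge0_le_integral => //.
  - by move=> u _; rewrite mule_ge0// rearr_ge0.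
  - exact: mprod.
  - apply: emeasurable_funM => //; apply/measurable_EFinP/measurable_funTS.
    exact: measurable_powR.
  - move=> u; rewrite /= in_itv/= => /andP[u0 _].
    rewrite -[leRHS]mule1; apply: lee_pmul; rewrite ?rearr_ge0//.
      by rewrite -EFinM; exact: rearr_kernel_col.
    apply: le_rearr_cst => //; first exact: ltW.
    by move=> x; rewrite I1 lee_fin indicE; case: (_ \in _).
rewrite ge0_integralZl//; last 3 first.
- by apply/measurable_EFinP/measurable_funTS; exact: measurable_powR.
- by move=> u _; rewrite lee_fin powR_ge0.
- by rewrite lee_fin ltW.
rewrite -mulrA EFinM; apply: lee_wpmul2l; first by rewrite lee_fin ltW.
exact: integral_powR_conjugate.
Qed.

Definition abs_potential (f : M -> R) x : \bar R :=
  \int[mu]_y (`|k x y| * f y)%:E.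

Lemma measurable_abs_potential (f : M -> R) : measurable_fun setT f ->
  (forall y, 0 <= f y)%R -> measurable_fun setT (abs_potential f).
Proof.
move=> mf f0.
apply: (@measurable_integral2 _ _ _ _ _ mu (fun p : M * M => (`|k p.1 p.2| * f p.2)%:E)) => //.
- apply/measurable_EFinP; apply: measurable_funM.
    exact: measurableT_comp measurable_kernel.
  exact: measurableT_comp.
- by move=> p; rewrite lee_fin mulr_ge0.
Qed.

Lemma abs_potential_ge0 (f : M -> R) x : (forall y, 0 <= f y)%R ->
  0 <= abs_potential f x.
Proof. by move=> f0; apply: integral_ge0 => y _; rewrite lee_fin mulr_ge0. Qed.

(** Exchanging the integrals puts the integral over [A] on a column of the kernel, where it is
    bounded uniformly in [y]. This is the duality against sets behind the weak-type estimate. *)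
Lemma integral_abs_potential (f : M -> R) (A : set M) t : measurable_fun setT f ->
  (forall y, 0 <= f y)%R -> measurable A -> (0 < t)%R -> mu A <= t%:E ->
  \int[mu]_(x in A) abs_potential f x <=
  (B * q * t `^ q^-1)%:E * \int[mu]_y (f y)%:E.
Proof.
move=> mf f0 mA t0 At; rewrite integral_indic_mul.
pose g (p : M * M) : \bar R := (\1_A p.1)%:E * (`|k p.1 p.2| * f p.2)%:E.
have mg : measurable_fun setT g.
  apply: emeasurable_funM.
    apply/measurable_EFinP; apply: measurableT_comp => //; exact: measurable_indic.
  apply/measurable_EFinP; apply: measurable_funM.
    exact: measurableT_comp measurable_kernel.
  exact: measurableT_comp.
have g0 p : 0 <= g p by rewrite mule_ge0// lee_fin ?mulr_ge0.
have mkf x : measurable_fun setT (fun y => (`|k x y| * f y)%:E).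
  apply/measurable_EFinP; apply: measurable_funM => //.
  by apply: measurableT_comp => //; exact: measurable_kernel_row.
have mkc y : measurable_fun setT (fun x => `|k x y|%:E).
  by apply/measurable_EFinP; apply: measurableT_comp => //; exact: measurable_kernel_col.
have -> : \int[mu]_x ((\1_A x)%:E * abs_potential f x) =
    \int[mu]_x \int[mu]_y g (x, y).
  apply: eq_integral => x _; rewrite /g/= ge0_integralZl//.
  by move=> y _; rewrite lee_fin mulr_ge0.
rewrite (exchange_integral mg g0 sf sf).
rewrite -ge0_integralZl//; last 3 first.
- exact/measurable_EFinP.
- by move=> y _; rewrite lee_fin.
- by rewrite lee_fin !mulr_ge0 ?powR_ge0// ltW.
apply: ge0_le_integral => //.
- by move=> y _; exact: integral_ge0.
- exact: (measurable_integral1 mg g0 sf).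
- by apply: emeasurable_funM => //; exact/measurable_EFinP.
move=> y _; have -> : \int[mu]_x g (x, y) = (f y)%:E * \int[mu]_(x in A) `|k x y|%:E.
  rewrite [in RHS]integral_indic_mul -ge0_integralZl//; last 2 first.
  - apply: emeasurable_funM => //; apply/measurable_EFinP; exact: measurable_indic.
  - by rewrite lee_fin.
  by apply: eq_integral => x _; rewrite /g/= -!EFinM; congr EFin; ring.
by rewrite muleC; apply: lee_wpmul2r; rewrite ?lee_fin//; exact: integral_kernel_col.
Qed.

(* Weak-type estimate: Chebyshev on a bounded piece of the superlevel set,
   whose measure is finite. *)
Lemma rearr_abs_potential (f : M -> R) u : measurable_fun setT f ->
  (forall y, 0 <= f y)%R -> (0 < u)%R ->
  rearr mu (abs_potential f) u <=
  (B * q * u `^ (- beta^-1))%:E * \int[mu]_y (f y)%:E.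
Proof.
move=> mf f0 u0; set I := \int[mu]_y (f y)%:E.
have I0 : 0 <= I by apply: integral_ge0 => y _; rewrite lee_fin.
have C0 : (0 < B * q * u `^ (- beta^-1))%R by rewrite !mulr_gt0// powR_gt0.
have [->|Iy] := eqVneq I +oo; first by rewrite gt0_muley ?leey// lte_fin.
have If : I \is a fin_num by rewrite ge0_fin_numE// ltey.
rewrite -(fineK If) -EFinM; set i := fine I.
have i0 : (0 <= i)%R by rewrite fine_ge0.
(* The slack [e] makes [s] positive even when [i = 0], and strictly larger than the bound, which the
   contradiction below requires. *)
apply/lee_addgt0Pr => e e0; rewrite -EFinD; set s := (_ * i + e)%R.
have s0 : (0 < s)%R by rewrite ltr_wpDl// mulr_ge0// ltW.
have mg := measurable_abs_potential mf f0.
rewrite rearr_le ?(ltW s0)//; apply: measure_le_bounded => //.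
  exact: measurable_superlevel.
move=> n; set A := _ `&` _; rewrite leNgt; apply/negP => uA.
have mA : measurable A.
  by apply: measurableI; [exact: measurable_superlevel|exact: measurable_cball].
have Afin : mu A \is a fin_num.
  rewrite ge0_fin_numE//; apply: le_lt_trans (cball_lty st point n%:R).
  by apply: le_measure; rewrite ?inE//; [exact: measurable_cball|exact: subIsetr].
move: uA; rewrite -(fineK Afin) lte_fin; set a := fine (mu A) => ua.
have a0 : (0 < a)%R by exact: lt_trans ua.
(* Chebyshev on [A], where the potential exceeds [s]. Dividing by [a] gives
   [s <= B q a^(-1/beta) i], and since [u < a] the right-hand side is at most [B q u^(-1/beta) i],
   which is less than [s]. *)
have : s%:E * a%:E <= (B * q * a `^ q^-1)%:E * I.
  apply: le_trans (integral_abs_potential mf f0 mA a0 _); last by rewrite /a fineK.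
  rewrite /a fineK// -integral_cst//; apply: ge0_le_integral => //.
  - by move=> x _; rewrite lee_fin ltW.
  - by apply: measurable_funTS.
  - move=> x [/= + _]; rewrite gee0_abs; last exact: abs_potential_ge0.
    exact: ltW.
rewrite -(fineK If) -!EFinM lee_fin -/i => sa.
have aq : (a `^ q^-1 = a * a `^ (- beta^-1))%R.
  have -> : (q^-1 = 1 + - beta^-1)%R.
    by rewrite -(conjugate_exponentP beta1) addrAC subrr add0r.
  by rewrite powRD ?powRr1 ?(ltW a0)// (gt_eqF a0) implybT.
have : (s <= B * q * a `^ (- beta^-1) * i)%R.
  rewrite -(ler_pM2r a0) (le_trans sa)// aq.
  by rewrite le_eqVlt; apply/orP; left; apply/eqP; ring.
rewrite leNgt => /negP; apply.
rewrite /s (@le_lt_trans _ _ (B * q * u `^ (- beta^-1) * i)%R) ?ltrDl//.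
rewrite ler_wpM2r// ler_wpM2l ?mulr_ge0 ?(ltW B0) ?(ltW q0)//.
rewrite !powRN lef_pV2 ?posrE ?powR_gt0//.
by apply: ge0_ler_powR; rewrite ?nnegrE ?invr_ge0 ?ltW.
Qed.

(** Integrating the weak-type bound over []0, t[] produces the second factor [q] of the constant
    [B q^2]. *)
Lemma integral_rearr_abs_potential (f : M -> R) t : measurable_fun setT f ->
  (forall y, 0 <= f y)%R -> (0 < t)%R ->
  \int[leb]_(u in `]0%R, t[) rearr mu (abs_potential f) u <=
  (B * q ^+ 2 * t `^ q^-1)%:E * \int[mu]_y (f y)%:E.
Proof.
move=> mf f0 t0; set I := \int[mu]_y (f y)%:E.
have I0 : 0 <= I by apply: integral_ge0 => y _; rewrite lee_fin.
have mp : measurable_fun `]0%R, t[ (fun u : R => (u `^ (- beta^-1))%:E).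
  by apply/measurable_EFinP/measurable_funTS; exact: measurable_powR.
have Bq0 : 0 <= (B * q)%:E by rewrite lee_fin mulr_ge0 ?ltW.
apply: (@le_trans _ _ (\int[leb]_(u in `]0%R, t[)
   (((B * q)%:E * I) * (u `^ (- beta^-1))%:E))).
  apply: ge0_le_integral => //.
  - by move=> u _; rewrite rearr_ge0.
  - exact: measurable_rearr.
  - exact: emeasurable_funM.
  - move=> u; rewrite /= in_itv/= => /andP[u0 _].
    by rewrite muleAC -EFinM; exact: rearr_abs_potential.
rewrite ge0_integralZl//; last 2 first.
- by move=> u _; rewrite lee_fin powR_ge0.
- exact: mule_ge0.
have -> : (B * q ^+ 2 * t `^ q^-1)%:E * I = (B * q)%:E * I * (q * t `^ q^-1)%:E.
  by rewrite [RHS]muleAC -EFinM expr2 !mulrA.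
apply: lee_wpmul2l; first exact: mule_ge0.
exact: integral_powR_conjugate.
Qed.

(* The hypotheses on [b] hold for [b = phi^*(t)], but also for [b = f^*(t)] when
   [phi = |f| 1_F] with [mu F = t]; in the latter case [phi^*(t) = 0]. *)
Lemma integral_truncation (phi : M -> R) b t : measurable_fun setT phi ->
  (0 <= b)%R -> (0 < t)%R ->
  (forall u, (u < t)%R -> b%:E <= rearr mu (EFin \o phi) u) ->
  distribution_fun mu (EFin \o phi) b <= t%:E -> (forall x, 0 <= phi x)%R ->
  \int[mu]_x (Num.max (phi x - b) 0)%:E + (b * t)%:E <=
  \int[leb]_(u in `]0%R, t[) rearr mu (EFin \o phi) u.
Proof.
move=> mphi b0 t0 bphi phib phi0; pose f1 x := Num.max (phi x - b)%R 0%R.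
have f10 x : (0 <= f1 x)%R by rewrite /f1 le_max lexx orbT.
have mf1 : measurable_fun setT f1.
  by apply: measurable_maxr => //; exact: measurable_funB.
have mEf1 : measurable_fun setT (EFin \o f1) by exact/measurable_EFinP.
have f1_s s x : (0 <= s)%R -> (s%:E < `|(f1 x)%:E|) = ((s + b)%:E < `|(phi x)%:E|).
  move=> s0; rewrite !lte_fin !ger0_norm// /f1 lt_max ltrBrDr.
  by rewrite (ltNge s 0%R) s0 orbF.
have f1dist s : (0 <= s)%R ->
    distribution_fun mu (EFin \o f1) s = distribution_fun mu (EFin \o phi) (s + b)%R.
  by move=> s0; congr (mu _); apply/seteqP; split => x /=; rewrite f1_s.
(* Hardy-Littlewood against the constant 1; beyond [t] the rearrangement of [f1] is 0 because [phi]
   exceeds [b] on a set of measure at most [t]. *)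
have le1 : \int[mu]_x (f1 x)%:E <= \int[leb]_(u in `]0%R, t[) rearr mu (EFin \o f1) u.
  have mc : measurable_fun setT (EFin \o cst 1%R : M -> \bar R) by exact/measurable_EFinP.
  have -> : \int[mu]_x (f1 x)%:E = \int[mu]_x (`|(EFin \o f1) x| * `|(EFin \o cst 1%R) x|).
    by apply: eq_integral => x _; rewrite /= normr1 mule1 ger0_norm.
  apply: (le_trans (hardy_littlewood sf mEf1 mc)).
  have mprod (D : set R) : measurable_fun D
      (fun u => rearr mu (EFin \o f1) u * rearr mu (EFin \o cst 1%R) u).
    by apply: emeasurable_funM; exact: measurable_rearr.
  rewrite (ge0_integral_itv0y_split t0)//; last first.
    by move=> u _; rewrite mule_ge0// rearr_ge0.
  rewrite [X in _ + X]integral0_eq ?adde0; last first.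
    move=> u/=; rewrite in_itv/= andbT => tu.
    rewrite [X in X * _](_ : _ = 0) ?mul0e//; apply/eqP; rewrite eq_le rearr_ge0 andbT.
    apply: ereal_inf_lbound; exists 0%R => //; split => //.
    by rewrite f1dist// add0r (le_trans phib)// lee_fin ltW.
  apply: ge0_le_integral => //.
  - by move=> u _; rewrite mule_ge0// rearr_ge0.
  - exact: mprod.
  - exact: measurable_rearr.
  - move=> u; rewrite /= in_itv/= => /andP[u0 _].
    rewrite -[leRHS]mule1; apply: lee_wpmul2l; first exact: rearr_ge0.
    by apply: le_rearr_cst; rewrite ?ltW// => x; rewrite /= normr1.
apply: (le_trans (leeD le1 (lexx _))).
have -> : (b * t)%:E = \int[leb]_(u in `]0%R, t[) b%:E.
  by rewrite integral_cst//= lebesgue_measure_itv/= lte_fin t0 sube0.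
rewrite -ge0_integralD//; last 2 first.
- by move=> u _; exact: rearr_ge0.
- exact: measurable_rearr.
apply: ge0_le_integral => //.
- by move=> u _; rewrite adde_ge0// ?rearr_ge0 ?lee_fin.
- by apply: emeasurable_funD => //; exact: measurable_rearr.
- exact: measurable_rearr.
move=> u; rewrite /= in_itv/= => /andP[u0 ut].
(* A level [s] admissible for [phi] at [u < t] is at least [b], and then [s - b] is admissible for
   [f1]; hence the rearrangement of [f1] plus [b] stays below that of [phi]. *)
apply: le_ereal_inf_tmp => _ [s [s0 hs] <-].
have bs : (b <= s)%R.
  rewrite -lee_fin (le_trans (bphi _ ut))//.
  by apply: ereal_inf_lbound; exists s.
rewrite -leeBrDr// -EFinB; apply: ereal_inf_lbound.
have sb0 : (0 <= s - b)%R by rewrite subr_ge0.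
by exists (s - b)%R => //; split => //; rewrite f1dist// subrK.
Qed.

(** Hardy-Littlewood split at [t]: up to [t] the rearrangement of [G] is at most [b] and the row
    bound is integrated; beyond [t] the row is replaced by [kernel_rearr]. *)
Lemma abs_potential_le_rearr (G : M -> R) x b t : measurable_fun setT G ->
  (forall y, 0 <= G y <= b)%R -> (0 < t)%R ->
  abs_potential G x <= (b * (B * q * t `^ q^-1))%:E +
    \int[leb]_(u in `]t, +oo[) (kernel_rearr mu k u * rearr mu (EFin \o G) u).
Proof.
move=> mG Gb t0; have b0 : (0 <= b)%R by have /andP[] := Gb point; exact: le_trans.
have mkr := measurable_kernel_row x.
have -> : abs_potential G x = \int[mu]_y (`|(EFin \o k x) y| * `|(EFin \o G) y|).
  by apply: eq_integral => y _; rewrite /= -EFinM (@ger0_norm _ (G y))//; case/andP: (Gb y).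
have mEG : measurable_fun setT (EFin \o G) by exact/measurable_EFinP.
apply: le_trans (hardy_littlewood sf _ mEG) _; first exact/measurable_EFinP.
have mprod (D : set R) : measurable_fun D
    (fun u => rearr mu (EFin \o k x) u * rearr mu (EFin \o G) u).
  by apply: emeasurable_funM; exact: measurable_rearr.
rewrite (ge0_integral_itv0y_split t0)//; last first.
  by move=> u _; rewrite mule_ge0// rearr_ge0.
apply: leeD; last first.
  apply: ge0_le_integral => //.
  - by move=> u _; rewrite mule_ge0// rearr_ge0.
  - exact: mprod.
  - by apply: emeasurable_funM; [exact: measurable_kernel_rearr|exact: measurable_rearr].
  - move=> u _; apply: lee_wpmul2r; first exact: rearr_ge0.
    exact: rearr_le_kernel_rearr.
have mp : measurable_fun `]0%R, t[ (fun u : R => (u `^ (- beta^-1))%:E).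
  by apply/measurable_EFinP/measurable_funTS; exact: measurable_powR.
apply: (@le_trans _ _ (\int[leb]_(u in `]0%R, t[) ((b * B)%:E * (u `^ (- beta^-1))%:E))).
  apply: ge0_le_integral => //.
  - by move=> u _; rewrite mule_ge0// rearr_ge0.
  - exact: mprod.
  - exact: emeasurable_funM.
  - move=> u; rewrite /= in_itv/= => /andP[u0 _].
    rewrite EFinM -muleA muleC; apply: lee_pmul; rewrite ?rearr_ge0//.
      apply: le_rearr_cst => //; first exact: ltW.
      by move=> y; rewrite /= lee_fin ger0_norm; case/andP: (Gb y).
    by rewrite -EFinM; exact: rearr_kernel_row.
rewrite ge0_integralZl//; last 2 first.
- by move=> u _; rewrite lee_fin powR_ge0.
- by rewrite lee_fin mulr_ge0// ltW.
have -> : (b * (B * q * t `^ q^-1) = b * B * (q * t `^ q^-1))%R by ring.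
rewrite [leRHS]EFinM; apply: lee_wpmul2l; first by rewrite lee_fin mulr_ge0// ltW.
exact: integral_powR_conjugate.
Qed.

(** Averaging the last hypothesis over []0, t[] gives [B q^2 t^(-1/beta)] times the integral of the
    truncation, plus [b B q t^(1/q)], plus [c]; [integral_truncation] bounds the first two together.
    In its use [c] contains the tail integral of the O'Neil functional. *)
Lemma rearr_avg_le (h : M -> \bar R) (phi : M -> R) (c : \bar R) b t :
  measurable_fun setT phi -> (forall x, 0 <= phi x)%R ->
  (0 <= b)%R -> (0 < t)%R -> 0 <= c ->
  (forall u, (u < t)%R -> b%:E <= rearr mu (EFin \o phi) u) ->
  distribution_fun mu (EFin \o phi) b <= t%:E ->
  (forall u, (0 < u < t)%R -> rearr mu h u <=
     rearr mu (abs_potential (fun y => Num.max (phi y - b) 0)%R) u +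
     ((b * (B * q * t `^ q^-1))%:E + c)) ->
  rearr_avg mu h t <= (B * q ^+ 2 * t `^ (- beta^-1))%:E *
    \int[leb]_(u in `]0%R, t[) rearr mu (EFin \o phi) u + c.
Proof.
move=> mphi phi0 b0 t0 c0 bphi phib hu; pose f1 y := Num.max (phi y - b)%R 0%R.
have f10 x : (0 <= f1 x)%R by rewrite /f1 le_max lexx orbT.
have mf1 : measurable_fun setT f1.
  by apply: measurable_maxr => //; exact: measurable_funB.
set c' := (_ + c) in hu.
have c'0 : 0 <= c'.
  apply: adde_ge0 => //; rewrite lee_fin.
  by rewrite !mulr_ge0 ?powR_ge0// ltW.
rewrite /rearr_avg.
have le1 : \int[leb]_(u in `]0%R, t[) rearr mu h u <=
    (B * q ^+ 2 * t `^ q^-1)%:E * \int[mu]_y (f1 y)%:E + c' * t%:E.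
  have -> : c' * t%:E = \int[leb]_(u in `]0%R, t[) c'.
    by rewrite integral_cst//= lebesgue_measure_itv/= lte_fin t0 sube0.
  apply: (@le_trans _ _ (\int[leb]_(u in `]0%R, t[) (rearr mu (abs_potential f1) u + c'))).
    apply: ge0_le_integral => //.
    - by move=> u _; exact: rearr_ge0.
    - exact: measurable_rearr.
    - by apply: emeasurable_funD => //; exact: measurable_rearr.
  rewrite ge0_integralD//; last 2 first.
  - by move=> u _; exact: rearr_ge0.
  - exact: measurable_rearr.
  by rewrite leeD2r//; exact: integral_rearr_abs_potential.
apply: (@le_trans _ _ (t^-1%:E * ((B * q ^+ 2 * t `^ q^-1)%:E * \int[mu]_y (f1 y)%:E + c' * t%:E))).
  by apply: lee_wpmul2l => //; rewrite lee_fin invr_ge0 ltW.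
have I0 : 0 <= \int[mu]_y (f1 y)%:E by apply: integral_ge0 => y _; rewrite lee_fin.
have Bq0 : (0 <= B * q ^+ 2)%R by rewrite mulr_ge0 ?sqr_ge0 ?ltW.
have tq : (t^-1 * t `^ q^-1 = t `^ (- beta^-1))%R.
  have -> : (q^-1 = 1 + - beta^-1)%R.
    by rewrite -(conjugate_exponentP beta1) addrAC subrr add0r.
  rewrite powRD ?powRr1 ?(ltW t0)// ?(gt_eqF t0) ?implybT//.
  by rewrite mulrA mulVf ?mul1r// gt_eqF.
rewrite ge0_muleDr//; last 2 first.
- by rewrite mule_ge0// lee_fin mulr_ge0// powR_ge0.
- by rewrite mule_ge0// lee_fin ltW.
rewrite muleA -EFinM mulrCA tq.
rewrite [X in _ + X]muleC -muleA -EFinM divff ?gt_eqF// mule1 /c' addeA.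
rewrite leeD2r//.
apply: (@le_trans _ _ ((B * q ^+ 2 * t `^ (- beta^-1))%:E *
    (\int[mu]_y (f1 y)%:E + (b * t)%:E))); last first.
  apply: lee_wpmul2l; first by rewrite lee_fin mulr_ge0// powR_ge0.
  exact: integral_truncation.
have bt0 : 0 <= (b * t)%:E by rewrite lee_fin mulr_ge0// ltW.
rewrite [leRHS]ge0_muleDr//; apply: leeD2l.
(* The bounded part carries one factor [q] less than the constant, and [q >= 1] absorbs the
   difference. *)
rewrite -EFinM lee_fin -tq.
have -> : (B * q ^+ 2 * (t^-1 * t `^ q^-1) * (b * t) = q * (b * (B * q * t `^ q^-1)))%R.
  by field; rewrite gt_eqF.
apply: ler_peMl; last exact/ltW/conjugate_exponent_gt1.
by rewrite !mulr_ge0 ?powR_ge0// ltW.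
Qed.

End oneil_core.

(** * O'Neil's inequality *)

Section auxiliary.
Context (R : realType).

(** An essential supremum is the infimum of the essential bounds, so an estimate by each bound
    passes to it. Nonnegativity excludes sums of opposite infinities. *)
Lemma lee_add_ereal_inf (a x : \bar R) (S : set (\bar R)) : 0 <= x ->
  (forall y, S y -> 0 <= y) -> (forall y, S y -> a <= x + y) ->
  a <= x + ereal_inf S.
Proof.
move=> x0 S0 Sa; have i0 : 0 <= ereal_inf S by exact: le_ereal_inf_tmp.
case: x x0 Sa => [x||//] x0 Sa; last by rewrite addye ?leey// gt_eqF// (lt_le_trans _ i0).
by rewrite -leeBlDl//; apply: le_ereal_inf_tmp => y /Sa; rewrite leeBlDl.
Qed.

(** The supremum over [E] need not be attained, but if it is positive then [q] times it is strictly
    smaller and some value exceeds that; if it is 0, every point of [E] serves. The bound by 1 keeps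
    it finite. *)
Lemma almost_maximizer (T : Type) (E : set T) (N : T -> \bar R) (q : R) :
  E !=set0 -> (0 <= q < 1)%R -> (forall x, 0 <= N x <= 1) ->
  exists2 z, E z & forall x, E x -> q%:E * N x <= N z.
Proof.
move=> [x0 Ex0] /andP[q0 q1] N01; set S := [set N x | x in E].
have NS x : E x -> N x <= ereal_sup S by move=> Ex; apply: ereal_sup_ubound; exists x.
have S0 : 0 <= ereal_sup S.
  by apply: le_trans (NS _ Ex0); case/andP: (N01 x0).
have Sfin : ereal_sup S \is a fin_num.
  rewrite ge0_fin_numE//; apply: (@le_lt_trans _ _ 1); last exact: ltry.
  by apply: ge_ereal_sup => _ [x _ <-]; case/andP: (N01 x).
have [S00|Spos] := eqVneq (ereal_sup S) 0.
  exists x0 => // x Ex; have -> : N x = 0.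
    by apply/eqP; rewrite eq_le -{1}S00 NS//=; case/andP: (N01 x).
  by rewrite mule0; case/andP: (N01 x0).
have Sgt0 : 0 < ereal_sup S by rewrite lt0e Spos.
have : q%:E * ereal_sup S < ereal_sup S.
  rewrite -(fineK Sfin) -EFinM lte_fin gtr_pMl//.
  by rewrite -lte_fin fineK.
move=> /ereal_sup_gt[_ [z Ez <-] qz]; exists z => // x Ex.
apply: le_trans (ltW qz); apply: lee_wpmul2l; first by rewrite lee_fin.
exact: NS.
Qed.

(** If the integral of [|a|] or that of [b] is infinite, the right-hand side is [+oo]; otherwise
    both functions are integrable. Only [a] gets its absolute value inside, so that the signed
    integral of [b] survives, as [potential_circ] requires. *)
Lemma abse_integral_add d (T : measurableType d) (m : {measure set T -> \bar R})
    (a b : T -> R) : measurable_fun setT a -> measurable_fun setT b ->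
  `|\int[m]_x (a x + b x)%:E| <= \int[m]_x `|a x|%:E + `|\int[m]_x (b x)%:E|.
Proof.
move=> ma mb; have mEa : measurable_fun setT (EFin \o a) by exact/measurable_EFinP.
have mEb : measurable_fun setT (EFin \o b) by exact/measurable_EFinP.
have [ay|ay] := eqVneq (\int[m]_x `|a x|%:E) +oo.
  by rewrite ay addye ?leey// gt_eqF// (lt_le_trans _ (abse_ge0 _)).
have [bfin|bN] := boolP (\int[m]_x (b x)%:E \is a fin_num); last first.
  suff -> : `|\int[m]_x (b x)%:E| = +oo.
    by rewrite addey ?leey// gt_eqF//; apply: lt_le_trans (integral_ge0 _ _).
  by move: bN; case: (\int[m]_x (b x)%:E).
have ia : m.-integrable setT (EFin \o a).
  apply/integrableP; split => //; rewrite ltey; apply: contra ay => /eqP ay.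
  by apply/eqP; rewrite -ay; apply: eq_integral.
have ib : m.-integrable setT (EFin \o b).
  apply/integrableP; split => //.
  by rewrite (integral_fin_num_abs m measurableT mb).
under eq_integral do rewrite EFinD.
rewrite integralD//; apply: (le_trans (lee_abs_add _ _)).
rewrite leeD2r//; apply: (le_trans (le_abse_integral _ _ mEa)) => //.
Qed.

End auxiliary.

Section rearr_more.
Context (R : realType) (d : measure_display) (M : borelMetricType R d).
Variable mu : {measure set M -> \bar R}.
Local Notation leb := (@lebesgue_measure R).
Implicit Types (h g : M -> \bar R) (s t u : R).

Lemma rearr_normr (f : M -> R) u :
  rearr mu (EFin \o (fun x => `|f x|%R)) u = rearr mu (EFin \o f) u.
Proof.
congr ereal_inf; rewrite /distribution_fun.
by under [in LHS]eq_fun do (rewrite /=; under eq_fun do rewrite /= normr_id).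
Qed.

(** If [s] is admissible for [g] at [u], then [s + c] is for [h]: on [E] off the null set [N],
    [|h| > s + c] forces [|g| > s]. The last hypothesis passes from [E], where the comparison is
    known, to the whole space. *)
Lemma rearr_le_add h g c (E N : set M) u :
  measurable_fun setT h -> measurable_fun setT g -> 0 <= c ->
  measurable E -> measurable N -> mu N = 0 ->
  (forall x, E x -> ~ N x -> `|h x| <= `|g x| + c) ->
  (forall s, (0 <= s)%R -> mu (E `&` [set x | s%:E < `|h x|]) <= u%:E ->
     distribution_fun mu h s <= u%:E) ->
  rearr mu h u <= rearr mu g u + c.
Proof.
move=> mh mg c0 mE mN N0 hg hE.
case: c c0 hg => [c||//] c0 hg; last first.
  by rewrite addey ?leey// gt_eqF// (lt_le_trans _ (rearr_ge0 _ _ _)).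
rewrite -leeBlDr//; apply: le_ereal_inf_tmp => _ [s [s0 gs] <-].
rewrite leeBlDr// -EFinD; apply: ereal_inf_lbound; exists (s + c)%R => //.
have sc0 : (0 <= s + c)%R by rewrite addr_ge0.
split => //; apply: hE => //.
have mlev r f := @measurable_superlevel R d M f r.
apply: (@le_trans _ _ (mu (N `|` [set x | s%:E < `|g x|]))).
  apply: le_measure; rewrite ?inE.
  - by apply: measurableI => //; exact: mlev.
  - by apply: measurableU => //; exact: mlev.
  - move=> x/= [Ex sx]; have [Nx|Nx] := pselect (N x); [by left|right].
    have := lt_le_trans sx (hg _ Ex Nx).
    by rewrite EFinD lteD2rE.
by rewrite setUC measureU0//; exact: mlev.
Qed.

Lemma rearr_le_rearr_avg h t : (0 < t)%R -> rearr mu h t <= rearr_avg mu h t.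
Proof.
move=> t0; have -> : rearr mu h t = t^-1%:E * \int[leb]_(u in `]0%R, t[) (rearr mu h t).
  rewrite integral_cst//= lebesgue_measure_itv/= lte_fin t0 sube0.
  by rewrite muleCA -EFinM mulVf ?mule1// gt_eqF.
apply: lee_wpmul2l; first by rewrite lee_fin invr_ge0 ltW.
apply: ge0_le_integral => //.
- by move=> u _; exact: rearr_ge0.
- exact: measurable_rearr.
- move=> u; rewrite /= in_itv/= => /andP[_ /ltW]; exact: rearr_nonincreasing.
Qed.

(** If [s >= h^*(tau)], the superlevel set lies in [E]. If [s < h^*(tau)], all of [E] lies in it and
    its measure [tau] exceeds [u], against the assumption. So below [tau] the rearrangement is
    decided on [E] alone. *)
Lemma level_set_distribution h (tau : R) (E : set M) s u :
  measurable_fun setT h -> level_set mu h tau E -> (u < tau)%R -> (0 <= s)%R ->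
  mu (E `&` [set x | s%:E < `|h x|]) <= u%:E -> distribution_fun mu h s <= u%:E.
Proof.
move=> mh [mE muE hE Eh] utau s0; have [hs|sh] := leP (rearr mu h tau) s%:E.
  move=> /(le_trans _); apply; rewrite /distribution_fun setIidr//.
  by move=> x/= sx; apply: hE => /=; exact: le_lt_trans sx.
rewrite setIidl ?muE ?lee_fin ?leNgt ?utau//.
by move=> x /Eh/=; exact: lt_le_trans.
Qed.

End rearr_more.

Section oneil_inequality.
Context (R : realType) (d : measure_display) (M : borelMetricType R d).
Variable mu : {measure set M -> \bar R}.
Variables (beta A0 Ainf B : R) (k : M -> M -> R).
Hypotheses (beta1 : (1 < beta)%R) (B0 : (0 < B)%R).
Hypotheses (st : standing mu) (rk : riesz_like mu beta k A0 Ainf B).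
Local Notation leb := (@lebesgue_measure R).
Local Notation q := (conjugate_exponent beta).
Local Notation C0 := (B * q ^+ 2)%R.
Implicit Types (x y : M) (s t u b : R).

Let q0 : (0 < q)%R. Proof. exact: lt_trans (conjugate_exponent_gt1 beta1). Qed.
Let sf : sigma_finite setT mu. Proof. exact: sigma_finite_standing. Qed.
Let mk : measurable_fun setT (fun p : M * M => k p.1 p.2).
Proof. exact: (measurable_kernel rk). Qed.
Let mkx x : measurable_fun setT (k x).
Proof. exact: (measurable_kernel_row rk). Qed.

Lemma measurable_potential (f : M -> R) : measurable_fun setT f ->
  measurable_fun setT (potential mu k f).
Proof.
move=> mf; pose g (p : M * M) := (k p.1 p.2 * f p.2)%:E.
have mg : measurable_fun setT g.
  by apply/measurable_EFinP; apply: measurable_funM => //; exact: measurableT_comp.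
have -> : potential mu k f =
    (fun x => \int[mu]_y g^\+ (x, y)) \- (fun x => \int[mu]_y g^\- (x, y)).
  apply/funext => x; rewrite /potential [LHS]integralE.
  by congr (_ - _); apply: eq_integral => y _; rewrite ?funeposE ?funenegE.
apply: emeasurable_funB; apply: measurable_integral2 => //.
- exact: measurable_funepos.
- exact: measurable_funeneg.
Qed.

Lemma abse_potential_le (f : M -> R) x : measurable_fun setT f ->
  `|potential mu k f x| <= abs_potential mu k (fun y => `|f y|%R) x.
Proof.
move=> mf; apply: (le_trans (le_abse_integral _ _ _)) => //.
  by apply/measurable_EFinP; exact: measurable_funM.
by rewrite le_eqVlt; apply/orP; left; apply/eqP; apply: eq_integral => y _; rewrite /= normrM.
Qed.

Lemma abs_potentialD (f g : M -> R) x :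
  measurable_fun setT f -> measurable_fun setT g ->
  (forall y, 0 <= f y)%R -> (forall y, 0 <= g y)%R ->
  abs_potential mu k (fun y => f y + g y)%R x =
  abs_potential mu k f x + abs_potential mu k g x.
Proof.
move=> mf mg f0 g0; rewrite /abs_potential.
under eq_integral do rewrite mulrDr EFinD.
have mkf (h : M -> R) : measurable_fun setT h ->
    measurable_fun setT (fun y => (`|k x y| * h y)%:E).
  by move=> mh; apply/measurable_EFinP; apply: measurable_funM => //; exact: measurableT_comp.
by rewrite ge0_integralD//; first [exact: mkf | move=> y _; rewrite lee_fin mulr_ge0].
Qed.

(** Common core of both inequalities. On [E] off a null set, [h] is controlled by the potential of
    the excess of [phi] over [b] and of a function [G] bounded by [b], up to a remainder [D]. Beyond
    [t], [psi] is what the rearrangement of [G] may add to that of [phi], at a cost of [D']. The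
    global inequality takes [E = setT] and [D = D' = 0]. *)
Lemma rearr_avg_le_split (h : M -> \bar R) (phi : M -> R) (D D' : \bar R)
    (E N : set M) b t :
  measurable_fun setT h ->
  measurable_fun setT phi -> (forall x, 0 <= phi x)%R ->
  (0 <= b)%R -> (0 < t)%R -> 0 <= D -> 0 <= D' ->
  (forall u, (u < t)%R -> b%:E <= rearr mu (EFin \o phi) u) ->
  distribution_fun mu (EFin \o phi) b <= t%:E ->
  measurable E -> measurable N -> mu N = 0 ->
  (forall u s, (u < t)%R -> (0 <= s)%R ->
     mu (E `&` [set x | s%:E < `|h x|]) <= u%:E ->
     distribution_fun mu h s <= u%:E) ->
  (forall x, E x -> ~ N x -> exists (G : M -> R) (psi : R -> \bar R),
     [/\ measurable_fun setT G, (forall y, 0 <= G y <= b)%R,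
         measurable_fun (`]t, +oo[%classic : set R) psi & forall u, 0 <= psi u] /\
     [/\ forall u, (t < u)%R ->
           rearr mu (EFin \o G) u <= rearr mu (EFin \o phi) u + psi u,
         \int[leb]_(u in `]t, +oo[) (kernel_rearr mu k u * psi u) <= D' &
         `|h x| <= abs_potential mu k (fun y => Num.max (phi y - b) 0 + G y)%R x + D]) ->
  rearr_avg mu h t <= oneil mu beta k C0 phi t + (D' + D).
Proof.
move=> mh mphi phi0 b0 t0 D0 D'0 bphi phib mE mN N0 hE hx.
set f1 := fun y => Num.max (phi y - b)%R 0%R.
have f10 x : (0 <= f1 x)%R by rewrite /f1 le_max lexx orbT.
have mf1 : measurable_fun setT f1.
  by apply: measurable_maxr => //; exact: measurable_funB.
have mprod (g : M -> \bar R) (D1 : set R) :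
    measurable_fun D1 (fun u => kernel_rearr mu k u * rearr mu g u).
  by apply: emeasurable_funM; [exact: measurable_kernel_rearr|exact: measurable_rearr].
have mprod2 (psi : R -> \bar R) (D1 : set R) : measurable_fun D1 psi ->
    measurable_fun D1 (fun u => kernel_rearr mu k u * psi u).
  by move=> mpsi; apply: emeasurable_funM => //; exact: measurable_kernel_rearr.
have kr0 u : 0 <= kernel_rearr mu k u by exact: kernel_rearr_ge0.
set J := \int[leb]_(u in `]t, +oo[) (kernel_rearr mu k u * rearr mu (EFin \o phi) u).
have J0 : 0 <= J by apply: integral_ge0 => u _; rewrite mule_ge0// rearr_ge0.
have mg1 := measurable_abs_potential st rk mf1 f10.
rewrite /oneil -addeA.
apply: (rearr_avg_le beta1 B0 st rk mphi phi0 b0 t0 _ bphi phib).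
  by apply: adde_ge0; [exact: J0|exact: adde_ge0].
move=> u /andP[u0 ut].
apply: (@rearr_le_add _ _ _ _ _ _ _ E N) => //.
- apply: adde_ge0; last by apply: adde_ge0; [exact: J0|exact: adde_ge0].
  by rewrite lee_fin !mulr_ge0 ?powR_ge0// ltW.
- move=> x Ex Nx; have [G [psi [[mG Gb mpsi psi0] [Gpsi psiD' hxG]]]] := hx x Ex Nx.
  have G0 y : (0 <= G y)%R by case/andP: (Gb y).
  apply: (le_trans hxG); rewrite abs_potentialD//.
  rewrite gee0_abs; last exact: abs_potential_ge0.
  have assoc (a1 a2 c j : \bar R) : a2 <= c + (j + D') ->
      a1 + a2 + D <= a1 + (c + (j + (D' + D))).
    by move=> ac; rewrite -addeA leeD2l// (addeA j) (addeA c) leeD2r.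
  apply: assoc; apply: (le_trans (abs_potential_le_rearr beta1 B0 st rk _ mG Gb t0)).
  apply: leeD2l.
  apply: (@le_trans _ _ (\int[leb]_(u in `]t, +oo[)
      (kernel_rearr mu k u * rearr mu (EFin \o phi) u + kernel_rearr mu k u * psi u))).
    apply: ge0_le_integral => //.
    + by move=> v _; rewrite mule_ge0// rearr_ge0.
    + exact: mprod.
    + by apply: emeasurable_funD; [exact: mprod|exact: mprod2].
    + move=> v; rewrite /= in_itv/= andbT => tv.
      rewrite -ge0_muleDr// ?rearr_ge0//; apply: lee_wpmul2l => //; exact: Gpsi.
  rewrite ge0_integralD//; last 4 first.
  + by move=> v _; rewrite mule_ge0// rearr_ge0.
  + exact: mprod.
  + by move=> v _; rewrite mule_ge0.
  + exact: mprod2.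
  exact: leeD2l.
- by move=> s s0; exact: hE.
Qed.

Lemma oneil_ge0 (C : R) (f : M -> R) t : (0 <= C)%R -> 0 <= oneil mu beta k C f t.
Proof.
move=> C0; apply: adde_ge0.
  rewrite mule_ge0 ?lee_fin ?mulr_ge0 ?powR_ge0//.
  by apply: integral_ge0 => u _; exact: rearr_ge0.
by apply: integral_ge0 => u _; rewrite mule_ge0 ?rearr_ge0// kernel_rearr_ge0.
Qed.

(** Settles the case where the rearrangement is infinite at [t], so that there is no real truncation
    level: the bound is then [+oo]. *)
Lemma oneil_pinfty (C : R) (f : M -> R) t : (0 < C)%R -> (0 < t)%R ->
  (forall u, (u < t)%R -> rearr mu (EFin \o f) u = +oo) ->
  oneil mu beta k C f t = +oo.
Proof.
move=> C0 t0 fy; rewrite /oneil.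
have -> : \int[leb]_(u in `]0%R, t[) rearr mu (EFin \o f) u =
    \int[leb]_(u in `]0%R, t[) (+oo : \bar R).
  by apply: eq_integral => u; rewrite inE/= in_itv/= => /andP[_]; exact: fy.
rewrite integral_cst//= lebesgue_measure_itv/= lte_fin t0 sube0.
rewrite gt0_mulye ?lte_fin// gt0_muley ?lte_fin ?mulr_gt0 ?powR_gt0// addye//.
rewrite gt_eqF//; apply: lt_le_trans (integral_ge0 _ _) => //.
by move=> u _; rewrite mule_ge0 ?rearr_ge0// kernel_rearr_ge0.
Qed.

Lemma oneil_normr (C : R) (f : M -> R) t :
  oneil mu beta k C (fun x => `|f x|%R) t = oneil mu beta k C f t.
Proof.
have e : rearr mu (EFin \o (fun x => `|f x|%R)) = rearr mu (EFin \o f).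
  by apply/funext => u; exact: rearr_normr.
by rewrite /oneil e.
Qed.

Let C00 : (0 < C0)%R. Proof. by rewrite mulr_gt0// exprn_gt0. Qed.

Lemma oneil_inequality (h : M -> R) t : measurable_fun setT h -> (0 < t)%R ->
  rearr_avg mu (potential mu k h) t <= oneil mu beta k C0 h t.
Proof.
move=> mh t0; pose phi x := `|h x|%R.
have mphi : measurable_fun setT phi by exact: measurableT_comp.
have mEphi : measurable_fun setT (EFin \o phi) by exact/measurable_EFinP.
have [hy|hN] := eqVneq (rearr mu (EFin \o phi) t) +oo.
  rewrite -oneil_normr oneil_pinfty ?leey// => u ut.
  by apply/eqP; rewrite -leye_eq -hy rearr_nonincreasing// ltW.
have hfin : rearr mu (EFin \o phi) t \is a fin_num.
  by rewrite ge0_fin_numE ?rearr_ge0// ltey.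
pose b := fine (rearr mu (EFin \o phi) t).
have b0 : (0 <= b)%R by rewrite fine_ge0// rearr_ge0.
rewrite -oneil_normr -[leRHS]adde0 -[X in _ + X]adde0.
apply: (@rearr_avg_le_split _ phi 0 0 setT set0 b) => //.
- exact: measurable_potential.
- by move=> x; exact: normr_ge0.
- by move=> u ut; rewrite /b fineK// rearr_nonincreasing// ltW.
- by rewrite -rearr_le// /b fineK.
- by move=> u s _ s0; rewrite setTI.
(* With [G = min(phi, b)] the sum of [(phi - b)^+] and [G] is [phi] itself. *)
move=> x _ _; exists (fun y => Num.min (phi y) b), (cst 0).
have mG : measurable_fun setT (fun y => Num.min (phi y) b) by exact: measurable_minr.
split; split => //.
- by move=> y; rewrite le_min ge_min lexx orbT b0 !andbT normr_ge0.
- move=> u _; rewrite adde0; apply: le_rearr => //; first exact/measurable_EFinP.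
  move=> y /=; rewrite lee_fin !ger0_norm ?ge_min ?lexx// ?normr_ge0// le_min b0 andbT normr_ge0//.
- by rewrite integral0_eq// => u _; rewrite mule0.
- rewrite adde0 (le_trans (abse_potential_le _ mh))//.
  rewrite [X in _ <= abs_potential _ _ X _](_ : _ = phi)//.
  by apply/funext => y; rewrite -/(phi y); case: (leP (phi y) b) => pb;
    [rewrite max_r ?add0r// subr_le0|rewrite max_l ?subrK// subr_ge0 ltW].
Qed.

End oneil_inequality.

(** * The tail term *)

Section tail.
Context (R : realType) (d : measure_display) (M : borelMetricType R d).
Variable mu : {measure set M -> \bar R}.
Variables (beta A0 Ainf B : R) (k : M -> M -> R).
Hypotheses (beta1 : (1 < beta)%R) (B0 : (0 < B)%R).
Hypotheses (st : standing mu) (rk : riesz_like mu beta k A0 Ainf B).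
Local Notation leb := (@lebesgue_measure R).
Local Notation q := (conjugate_exponent beta).
Implicit Types (x y : M) (s t u b tau : R).

Let beta0 : (0 < beta)%R. Proof. exact: lt_trans beta1. Qed.
Let q0 : (0 < q)%R. Proof. exact: lt_trans (conjugate_exponent_gt1 beta1). Qed.
Let sf : sigma_finite setT mu. Proof. exact: sigma_finite_standing. Qed.

Lemma measure_volball_le x tau (E : set M) : measurable E -> E x ->
  mu E = tau%:E -> mu (volball mu x tau) <= tau%:E.
Proof.
move=> mE Ex muE; rewrite /volball /volradius; set S := [set r | _].
have [S0|/set0P[r [r0 vr]]] := eqVneq S set0.
  (* With no radius of volume [tau] the infimum defaults to 0, and the ball is [{x}], contained in
     [E]. *)
  rewrite S0 inf0 -muE; apply: le_measure; rewrite ?inE//; first exact: measurable_cball.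
  move=> y; rewrite /cball/= => xy; suff <- : x = y by [].
  by apply: mdist_positivity; apply/eqP; rewrite eq_le xy mdist_ge0.
rewrite -vr (volE st); apply: le_measure; rewrite ?inE; try exact: measurable_cball.
apply: subset_cball; apply: ge_inf; last by split.
by exists 0%R => s [/ltW].
Qed.

(** Bounds what a function living off [F] adds to a rearrangement after the measure [tau] of [F] has
    been used up: its own rearrangement, translated by [tau] and extended by 0 to the left. *)
Definition shifted_rearr (g : M -> R) tau : R -> \bar R :=
  (fun u => rearr mu (EFin \o g) (u - tau)%R) \_ `[tau, +oo[.

Lemma shifted_rearrE (g : M -> R) tau u : shifted_rearr g tau u =
  if (tau <= u)%R then rearr mu (EFin \o g) (u - tau)%R else 0.
Proof.
rewrite /shifted_rearr patchE; case: ifPn => [|] ; rewrite ?inE/= ?notin_setE/= in_itv/= andbT.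
  by move=> ->.
by move=> /negP/negbTE ->.
Qed.

Lemma shifted_rearr_ge0 (g : M -> R) tau u : 0 <= shifted_rearr g tau u.
Proof. by rewrite shifted_rearrE; case: ifP => // _; exact: rearr_ge0. Qed.

Lemma measurable_shifted_rearr (g : M -> R) tau (D : set R) :
  measurable_fun D (shifted_rearr g tau).
Proof.
apply: (@measurable_funS _ _ _ _ setT) => //.
have mI : measurable (`[tau, +oo[%classic : set R) by exact: measurable_itv.
apply: (measurable_restrictT _ mI).1.
apply: nonincreasing_emeasurable => u v uv; apply: rearr_nonincreasing.
exact: lerB.
Qed.

(* The shifted rearrangement is equimeasurable with [g]. *)
Lemma Lnorm_shifted_rearr (g : M -> R) tau b : measurable_fun setT g ->
  (forall y, 0 <= g y <= b)%R -> distribution_fun mu (EFin \o g) 0 < +oo ->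
  'N[leb]_q%:E[EFin \o (fine \o shifted_rearr g tau)] <= 'N[mu]_q%:E[EFin \o g].
Proof.
move=> mg gb gfin; have g0 y : (0 <= g y)%R by case/andP: (gb y).
set P := fine \o shifted_rearr g tau.
have mEg : measurable_fun setT (EFin \o g) by exact/measurable_EFinP.
have P0 u : (0 <= P u)%R by rewrite fine_ge0// shifted_rearr_ge0.
have mP : measurable_fun (@setT (measurableTypeR R)) P.
  by apply: measurableT_comp => //; exact: measurable_shifted_rearr.
have Psi u : (P u)%:E = shifted_rearr g tau u.
  rewrite /P/= fineK// ge0_fin_numE ?shifted_rearr_ge0// shifted_rearrE.
  case: ifPn => // tu; apply: (@le_lt_trans _ _ b%:E); last exact: ltry.
  apply: le_rearr_cst; first by case/andP: (gb point); exact: le_trans.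
    by rewrite subr_ge0.
  by move=> y /=; rewrite lee_fin ger0_norm//; case/andP: (gb y).
rewrite unlock; apply: gt0_ler_poweR; first by rewrite invr_ge0 ltW.
- by rewrite in_itv/= leey andbT integral_ge0// => u _; rewrite poweR_ge0.
- by rewrite in_itv/= leey andbT integral_ge0// => u _; rewrite poweR_ge0.
have mpow d' (T : measurableType d') (f : T -> R) : measurable_fun setT f ->
    measurable_fun setT (fun w : T => (f w `^ q)%:E).
  by move=> mf; apply/measurable_EFinP; apply: (measurableT_comp (f := @powR R ^~ q)).
have -> : \int[leb]_u `|(EFin \o P) u| `^ q = \int[leb]_u (1 * (P u `^ q)%:E).
  by apply: eq_integral => u _; rewrite mul1e/= ger0_norm.
have -> : \int[mu]_x `|(EFin \o g) x| `^ q = \int[mu]_x (1 * (g x `^ q)%:E).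
  by apply: eq_integral => u _; rewrite mul1e/= ger0_norm.
apply: (le_integral_layer (@sigma_finite_lebesgue R) sf) => //.
- exact: mpow.
- exact: mpow.
- by move=> u; rewrite lee_fin powR_ge0.
- by move=> u; rewrite lee_fin powR_ge0.
move=> r r0; under eq_integral do rewrite mul1e.
under [leRHS]eq_integral do rewrite mul1e.
have mlt d' (T : measurableType d') (f : T -> R) : measurable_fun setT f ->
    measurable_fun setT (fun w : T => r%:E < (f w `^ q)%:E).
  by move=> mf; apply: measurable_fun_lte => //; exact: mpow.
rewrite !integral_bool_natr; [|exact: mlt..].
set s := (r `^ q^-1)%R.
have s0 : (0 <= s)%R by rewrite powR_ge0.
have rs (v : R) : (0 <= v)%R -> (r%:E < (v `^ q)%:E) = (s < v)%R.
  move=> v0; rewrite lte_fin.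
  have rE : r = (s `^ q)%R by rewrite /s -powRrM mulVf ?powRr1// gt_eqF.
  rewrite [in LHS]rE; apply/idP/idP.
    apply: contraTT; rewrite -!leNgt => vs.
    by apply: ge0_ler_powR => //; exact: ltW.
  by move=> sv; apply: gt0_ltr_powR.
have dE : mu [set x | r%:E < (g x `^ q)%:E] = distribution_fun mu (EFin \o g) s.
  by congr (mu _); apply/seteqP; split => x /=; rewrite rs// lte_fin ger0_norm.
rewrite dE; have dfin : distribution_fun mu (EFin \o g) s \is a fin_num.
  rewrite ge0_fin_numE ?measure_ge0//; apply: le_lt_trans gfin.
  exact: distribution_fun_nonincreasing.
pose a := fine (distribution_fun mu (EFin \o g) s).
have a0 : (0 <= a)%R by rewrite fine_ge0// measure_ge0.
(* The shifted rearrangement exceeds [s] only between [tau] and [tau + a], where [a] is the measure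
   of [{g > s}]. *)
apply: (@le_trans _ _ (leb `[tau, (tau + a)%R[%classic)); last first.
  rewrite lebesgue_measure_itv/= lte_fin ltrDl; case: ifPn => [_|].
    by rewrite -EFinB addrAC subrr add0r /a fineK.
  by rewrite measure_ge0.
apply: le_measure; rewrite ?inE.
- rewrite -[X in measurable X]setTI; exact: (mlt _ (measurableTypeR R) P mP measurableT [set true]).
- exact: measurable_itv.
move=> u /=; rewrite rs// -lte_fin Psi shifted_rearrE in_itv/=; case: ifPn => tu.
  by rewrite rearr_gt// -(fineK dfin) lte_fin ltrBlDl.
by rewrite lte_fin ltNge s0.
Qed.

(** The power [beta] of [u^(-1/beta)] is [1/u], whose integral over a doubling interval is [ln 2]
    whatever [tau] is. *)
Lemma Lnorm_powR_doubling tau : (0 < tau)%R ->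
  'N[leb]_beta%:E[EFin \o (fun u => u `^ (- beta^-1) * \1_`[tau, (2 * tau)%R] u)%R] =
  (ln 2 `^ beta^-1)%:E.
Proof.
move=> tau0; rewrite unlock -poweR_EFin -(integral_invr_doubling tau0) [in RHS]integral_indic_mul.
congr (_ `^ _); apply: eq_integral => u _ /=; rewrite indicE.
case: (boolP (u \in _)); rewrite ?inE/= ?in_itv/=.
  move=> /andP[tu _]; have u0 : (0 < u)%R by exact: lt_le_trans tu.
  rewrite mulr1 mul1e ger0_norm ?powR_ge0// -powRrM mulNr mulVf ?gt_eqF//.
  by rewrite powR_inv1// ltW.
by move=> _; rewrite mulr0 normr0 powR0 ?gt_eqF// mul0e.
Qed.

Lemma tail_estimate (g : M -> R) b tau t : measurable_fun setT g ->
  (forall y, 0 <= g y <= b)%R -> (0 < t)%R -> (t <= tau)%R ->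
  distribution_fun mu (EFin \o g) 0 <= tau%:E ->
  \int[leb]_(u in `]t, +oo[) (kernel_rearr mu k u * shifted_rearr g tau u) <=
  (B * ln 2 `^ beta^-1)%:E * 'N[mu]_q%:E[EFin \o g].
Proof.
move=> mg gb t0 ttau g0tau.
have g0 y : (0 <= g y)%R by case/andP: (gb y).
have tau0 : (0 < tau)%R by exact: lt_le_trans ttau.
pose P : measurableTypeR R -> R := fine \o shifted_rearr g tau.
pose Fd : measurableTypeR R -> R := (fun u => u `^ (- beta^-1) * \1_`[tau, (2 * tau)%R] u)%R.
have mP : measurable_fun setT P.
  by apply: measurableT_comp => //; exact: measurable_shifted_rearr.
have mFd : measurable_fun setT Fd.
  apply: measurable_funM; first exact: measurable_powR.
  by apply: measurable_indic; exact: measurable_itv.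
have P0 u : (0 <= P u)%R by rewrite fine_ge0// shifted_rearr_ge0.
have Fd0 u : (0 <= Fd u)%R by rewrite mulr_ge0 ?powR_ge0.
have Psi u : shifted_rearr g tau u = (P u)%:E.
  rewrite /P/= fineK// ge0_fin_numE ?shifted_rearr_ge0// shifted_rearrE.
  case: ifPn => // tu; apply: (@le_lt_trans _ _ b%:E); last exact: ltry.
  apply: le_rearr_cst; first by case/andP: (gb point); exact: le_trans.
    by rewrite subr_ge0.
  by move=> y /=; rewrite lee_fin ger0_norm//; case/andP: (gb y).
have mPF : measurable_fun setT (fun u => (Fd u * P u)%:E).
  by apply/measurable_EFinP; exact: measurable_funM.
have FP0 u : 0 <= (Fd u * P u)%:E by rewrite lee_fin mulr_ge0.
have B0' : 0 <= B%:E by rewrite lee_fin ltW.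
apply: (@le_trans _ _ (\int[leb]_(u in `]t, +oo[) (B%:E * (Fd u * P u)%:E))).
  apply: ge0_le_integral => //.
  - by move=> u _; rewrite mule_ge0 ?shifted_rearr_ge0// (kernel_rearr_ge0 mu k).
  - apply: emeasurable_funM; first exact: measurable_kernel_rearr.
    exact: measurable_shifted_rearr.
  - by apply: emeasurable_funM => //; exact: measurable_funTS.
  - move=> u; rewrite /= in_itv/= andbT => tu.
    have u0 : (0 < u)%R by exact: lt_trans tu.
    have [tauu|utau] := leP tau u; last first.
      by rewrite shifted_rearrE (lt_geF utau) mule0 mule_ge0.
    (* For [u > 2 tau] the argument [u - tau] exceeds [tau], hence the measure of [{g > 0}], and the
       rearrangement is 0 there. *)
    have [u2|u2] := leP u (2 * tau)%R; last first.
      rewrite shifted_rearrE tauu [X in _ * X](_ : _ = 0) ?mule0 ?mule_ge0//.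
      apply/eqP; rewrite eq_le rearr_ge0 andbT; apply: ereal_inf_lbound.
      exists 0%R => //; split => //; rewrite (le_trans g0tau)// lee_fin lerBrDr.
      by rewrite (le_trans _ (ltW u2))// mulr_natl mulr2n.
    rewrite Psi EFinM muleA; apply: lee_wpmul2r; first by rewrite lee_fin.
    rewrite /Fd indicE mem_set ?mulr1; last by rewrite /= in_itv/= tauu u2.
    by rewrite -EFinM; exact: (kernel_rearr_le beta1 B0 st rk).
apply: (@le_trans _ _ (\int[leb]_u (B%:E * (Fd u * P u)%:E))).
  apply: ge0_subset_integral => //.
  - exact: emeasurable_funM.
  - by move=> u _; exact: mule_ge0.
rewrite ge0_integralZl// EFinM -muleA; apply: lee_wpmul2l => //.
have -> : \int[leb]_u (Fd u * P u)%:E = 'N[leb]_1[EFin \o (Fd \* P)%R].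
  by rewrite Lnorm1; apply: eq_integral => u _; rewrite /= ger0_norm// mulr_ge0.
apply: (le_trans (hoelder leb mFd mP beta0 q0 (conjugate_exponentP beta1))).
rewrite Lnorm_powR_doubling//; apply: lee_wpmul2l; first by rewrite lee_fin powR_ge0.
apply: (Lnorm_shifted_rearr tau mg gb).
exact: le_lt_trans g0tau (ltry _).
Qed.

End tail.

(** * Localization to level sets *)

Section localized_potential.
Context (R : realType) (d : measure_display) (M : borelMetricType R d).
Variable mu : {measure set M -> \bar R}.
Variables (beta A0 Ainf B : R) (k : M -> M -> R).
Hypotheses (beta1 : (1 < beta)%R) (B0 : (0 < B)%R).
Hypotheses (st : standing mu) (rk : riesz_like mu beta k A0 Ainf B).
Local Notation q := (conjugate_exponent beta).
Local Notation C0 := (B * q ^+ 2)%R.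
Variables (f : M -> R) (tau : R) (F E : set M).
Hypotheses (mf : measurable_fun [set: M] f) (tau0 : (0 < tau)%R).
Hypothesis hF : level_set mu (EFin \o f) tau F.
Hypothesis hE : level_set mu (potential mu k f) tau E.
Implicit Types (x y : M) (s t u : R).

(** For each [x], [f] is the sum of [fin], its part on [F], of [loc x], its part off [F] inside
    [volball mu x tau], and of [rem x], the rest, whose potential is measured by
    [potential_circ]. *)
Let fin : M -> R := (f \* \1_F)%R.
Let loc x : M -> R := (f \* \1_(~` F) \* \1_(volball mu x tau))%R.
Let rem x : M -> R := (fun y => f y * \1_(~` F) y * \1_(~` volball mu x tau) y)%R.

Let q0 : (0 < q)%R. Proof. exact: lt_trans (conjugate_exponent_gt1 beta1). Qed.
Let C00 : (0 < C0)%R. Proof. by rewrite mulr_gt0// exprn_gt0. Qed.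
Let mF : measurable F. Proof. by case: hF. Qed.
Let muF : mu F = tau%:E. Proof. by case: hF. Qed.
Let mE : measurable E. Proof. by case: hE. Qed.
Let muE : mu E = tau%:E. Proof. by case: hE. Qed.
Let mEf : measurable_fun setT (EFin \o f). Proof. exact/measurable_EFinP. Qed.
Let mV x : measurable (volball mu x tau). Proof. exact: measurable_cball. Qed.
Let mfin : measurable_fun setT fin.
Proof. by apply: measurable_funM => //; exact: measurable_indic. Qed.
Let mloc x : measurable_fun setT (loc x).
Proof.
apply: measurable_funM; last exact: measurable_indic.
by apply: measurable_funM => //; apply: measurable_indic; exact: measurableC.
Qed.
Let mrem x : measurable_fun setT (rem x).
Proof.
apply: measurable_funM; last by apply: measurable_indic; exact: measurableC.
by apply: measurable_funM => //; apply: measurable_indic; exact: measurableC.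
Qed.

Let finT y : F y -> fin y = f y.
Proof. by move=> Fy; rewrite /fin/= indicE mem_set// mulr1. Qed.
Let finN y : ~ F y -> fin y = 0%R.
Proof. by move=> Fy; rewrite /fin/= indicE memNset// mulr0. Qed.
Let locT x y : F y -> loc x y = 0%R.
Proof.
by move=> Fy; rewrite /loc/= indicE memNset ?mulr0 ?mul0r//; apply/not_notP.
Qed.
Let loc_le x y : (`|loc x y| <= `|f y|)%R.
Proof.
rewrite /loc/= !indicE; case: (_ \in ~` F); case: (_ \in volball _ _ _);
  by rewrite ?mulr1 ?mulr0 ?mul0r ?normr0.
Qed.
Let split_f x y : f y = (fin y + loc x y + rem x y)%R.
Proof.
rewrite /fin /loc /rem/= !indicE !in_setC.
by case: (y \in F); case: (y \in volball _ _ _); rewrite /= ?mulr1 ?mulr0 ?mul0r ?addr0 ?add0r.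
Qed.

Lemma rearr_le_level_part u : (u < tau)%R ->
  rearr mu (EFin \o f) u <= rearr mu (EFin \o fin) u.
Proof.
move=> utau; apply: rearr_le_rearr => s s0 fs.
apply: (level_set_distribution mEf hF utau s0); apply: le_trans fs.
apply: le_measure; rewrite ?inE.
- by apply: measurableI => //; exact: measurable_superlevel.
- by apply: measurable_superlevel; exact/measurable_EFinP.
- by move=> y/= [Fy sf]; rewrite finT.
Qed.

Lemma normr_le_rearr_compl y : ~ F y -> `|f y|%:E <= rearr mu (EFin \o f) tau.
Proof.
move=> Fy; rewrite leNgt; apply/negP => fy; apply: Fy.
by case: hF => _ _ + _; apply => /=.
Qed.

Lemma Lnorm_localized_le1 x : 'N[mu]_q%:E[EFin \o f] <= 1 -> 'N[mu]_q%:E[EFin \o loc x] <= 1.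
Proof.
apply: le_trans; rewrite unlock; apply: gt0_ler_poweR; first by rewrite invr_ge0 ltW.
- by rewrite in_itv/= leey andbT integral_ge0// => u _; rewrite poweR_ge0.
- by rewrite in_itv/= leey andbT integral_ge0// => u _; rewrite poweR_ge0.
have mpow (g : M -> R) : measurable_fun setT g ->
    measurable_fun setT (fun w => `|(EFin \o g) w| `^ q).
  move=> mg; apply/measurable_EFinP; apply: (measurableT_comp (f := @powR R ^~ q)) => //.
  exact: measurableT_comp.
apply: ge0_le_integral => //.
- by move=> y _; rewrite poweR_ge0.
- exact: mpow.
- exact: mpow.
- move=> y _; rewrite /= lee_fin; apply: ge0_ler_powR; rewrite ?nnegrE//.
  exact: ltW.
Qed.

(** [E] has positive measure, so an essential bound on [E] is tested at some point of [E]. On a null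
    set the infimum in [ess_sup_on] would be [-oo]. *)
Lemma ess_bound_ge0 (h : M -> \bar R) (w : \bar R) : (forall x, 0 <= h x) ->
  (\forall x \ae mu, E x -> h x <= w) -> 0 <= w.
Proof.
move=> h0 [N [mN N0 hN]].
have /set0P[x [Ex Nx]] : E `\` N != set0.
  apply/negP => /eqP EN; have : mu E <= mu N.
    apply: le_measure; rewrite ?inE// => x Ex.
    by apply: contrapT => Nx; have : set0 x by rewrite -EN.
  by rewrite muE N0 lee_fin leNgt tau0.
have : h x <= w by apply: contrapT => hw; apply: Nx; apply: hN => /= H; apply: hw; exact: H.
exact: le_trans.
Qed.

Lemma rearr_avg_potential_le (z : M) t : (0 < t)%R -> (t <= tau)%R ->
  (forall x, E x -> (ln 2 `^ beta^-1)%:E * 'N[mu]_q%:E[EFin \o loc x] <=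
     'N[mu]_q%:E[EFin \o loc z]) ->
  rearr_avg mu (potential mu k f) t <= oneil mu beta k C0 fin t +
    B%:E * 'N[mu]_q%:E[EFin \o loc z] + potential_circ mu k f F E tau.
Proof.
move=> t0 ttau zmax.
have circ0 (w : \bar R) : (\forall x \ae mu, E x -> `|potential mu k (rem x) x| <= w) ->
    0 <= w by apply: ess_bound_ge0.
have BN0 : 0 <= B%:E * 'N[mu]_q%:E[EFin \o loc z].
  by rewrite mule_ge0 ?Lnorm_ge0// lee_fin ltW.
(* The infimum [potential_circ] is next replaced by a single essential bound [w]; all other terms
   must be nonnegative for this. *)
have on0 : 0 <= oneil mu beta k C0 fin t by apply: oneil_ge0; exact: ltW.
apply: lee_add_ereal_inf => // [|w aew]; first exact: adde_ge0.
have w0 := circ0 w aew.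
have [fy|fN] := eqVneq (rearr mu (EFin \o f) t) +oo.
  rewrite oneil_pinfty// => [|u ut].
    by rewrite -addeA addye ?leey// gt_eqF// (lt_le_trans _ (adde_ge0 BN0 w0)).
  apply/eqP; rewrite -leye_eq -fy.
  apply: le_trans (rearr_le_level_part (lt_le_trans ut ttau)).
  by apply: rearr_nonincreasing; exact: ltW.
have ffin : rearr mu (EFin \o f) t \is a fin_num.
  by rewrite ge0_fin_numE ?rearr_ge0// ltey.
(* The level is that of [f], not of [phi]: off [F], [|f|] is at most [f^*(tau) <= f^*(t) = b], so
   this level also bounds the local part. *)
pose b := fine (rearr mu (EFin \o f) t).
have b0 : (0 <= b)%R by rewrite fine_ge0// rearr_ge0.
pose phi y := `|fin y|%R.
have phi0 y : (0 <= phi y)%R by exact: normr_ge0.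
have mphi : measurable_fun setT phi by exact: measurableT_comp.
have mEphi : measurable_fun setT (EFin \o phi) by exact/measurable_EFinP.
case: aew => N [mN N0 hN].
rewrite -oneil_normr -addeA.
apply: (@rearr_avg_le_split _ _ _ mu _ _ _ _ _ beta1 B0 st rk _ phi w _ E N b) => //.
- exact: (measurable_potential st rk).
- move=> u ut; rewrite /b fineK// rearr_normr.
  apply: le_trans (rearr_le_level_part (lt_le_trans ut ttau)).
  by apply: rearr_nonincreasing; exact: ltW.
- apply: (@le_trans _ _ (distribution_fun mu (EFin \o f) b)); last first.
    by rewrite -rearr_le// /b fineK.
  apply: le_distribution_fun => // y; rewrite /= lee_fin normr_id.
  by have [Fy|Fy] := pselect (F y); [rewrite /phi finT|rewrite /phi finN// normr0].
- move=> u s ut s0.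
  apply: (level_set_distribution (measurable_potential st rk mf) hE) => //.
  exact: lt_le_trans ttau.
move=> x Ex Nx; pose g y := `|loc x y|%R.
have mg : measurable_fun setT g by exact: measurableT_comp.
have mEg : measurable_fun setT (EFin \o g) by exact/measurable_EFinP.
have g0 y : (0 <= g y)%R by exact: normr_ge0.
have gN y : ~ F y -> (g y)%:E <= rearr mu (EFin \o f) tau.
  by move=> /normr_le_rearr_compl; apply: le_trans; rewrite lee_fin loc_le.
have gb y : (0 <= g y <= b)%R.
  rewrite g0/=; have [Fy|Fy] := pselect (F y); first by rewrite /g locT// normr0.
  rewrite -lee_fin /b fineK// (le_trans (gN _ Fy))//.
  exact: rearr_nonincreasing.
pose G y := (Num.min (phi y) b + g y)%R.
have GT y : F y -> G y = Num.min (phi y) b.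
  by move=> Fy; rewrite /G /g locT// normr0 addr0.
have GN y : ~ F y -> G y = g y.
  by move=> Fy; rewrite /G /phi finN// normr0 min_l// add0r.
have mG : measurable_fun setT G.
  by apply: measurable_funD => //; exact: measurable_minr.
have mEG : measurable_fun setT (EFin \o G) by exact/measurable_EFinP.
have Gb y : (0 <= G y <= b)%R.
  have [Fy|Fy] := pselect (F y); last by rewrite GN.
  by rewrite GT// le_min phi0 b0 ge_min lexx orbT.
have G0 y : (0 <= G y)%R by case/andP: (Gb y).
have g0tau : distribution_fun mu (EFin \o g) 0 <= tau%:E.
  apply: le_trans (measure_volball_le st mE Ex muE).
  apply: le_measure; rewrite ?inE//; first exact: measurable_superlevel.
  move=> y /=; rewrite lte_fin normr_id /g /loc/= [\1_(volball _ _ _) y]indicE.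
  by case: (boolP (y \in _)); rewrite ?mulr0 ?normr0 ?ltxx// inE.
exists G, (shifted_rearr mu g tau); split; split => //.
- exact: measurable_shifted_rearr.
- by move=> u; exact: shifted_rearr_ge0.
(* For [u >= tau], the set [F] adds at most [tau] to the measure of [{G > s}], so the rearrangement
   of [G] at [u] is at most that of [g] at [u - tau]. *)
- move=> u tu; rewrite shifted_rearrE; case: ifPn => [tauu|].
    apply: (@le_trans _ _ (rearr mu (EFin \o g) (u - tau)%R)); last first.
      by rewrite leeDr// rearr_ge0.
    apply: rearr_le_rearr => s s0 gs.
    apply: (@le_trans _ _ (mu (F `|` [set y | s%:E < `|(EFin \o g) y|]))).
      apply: le_measure; rewrite ?inE.
      + exact: measurable_superlevel.
      + by apply: measurableU => //; exact: measurable_superlevel.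
      + move=> y /=; have [Fy|Fy] := pselect (F y); first by left.
        by rewrite GN//; right.
    apply: (@le_trans _ _ (mu F + distribution_fun mu (EFin \o g) s)).
      by apply: measureU2 => //; exact: measurable_superlevel.
    by rewrite muF -leeBrDl// -EFinB.
  (* For [u < tau] a level [s] admissible for [phi] is at least [f^*(tau)], since otherwise [F], of
     measure [tau], would lie in [{phi > s}]. At such levels [g] contributes nothing. *)
  rewrite -ltNge => utau; rewrite adde0; apply: rearr_le_rearr => s s0 phis.
  have [fs|sf] := leP (rearr mu (EFin \o f) tau) s%:E.
    apply: le_trans phis; apply: le_measure; rewrite ?inE; try exact: measurable_superlevel.
    move=> y /=; have [Fy|Fy] := pselect (F y).
      rewrite GT// !lte_fin !ger0_norm// ?le_min ?phi0//.
      by move=> /lt_le_trans; apply; rewrite ge_min lexx.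
    rewrite GN// lte_fin ger0_norm// => sg; exfalso; move: sg.
    by apply/negP; rewrite -leNgt -lee_fin (le_trans (gN _ Fy)).
  exfalso; move: phis; apply/negP; rewrite -ltNge.
  apply: (@lt_le_trans _ _ (mu F)); first by rewrite muF lte_fin.
  apply: le_measure; rewrite ?inE//; first exact: measurable_superlevel.
  move=> y Fy /=; rewrite normr_id finT//.
  by case: hF => _ _ _ /(_ _ Fy)/=; exact: lt_le_trans.
(* Here the point [z] enters: with the factor [(ln 2)^(1/beta)], the local norm at [x] is dominated
   by the one at [z]. *)
- apply: (le_trans (tail_estimate beta1 B0 st rk mg gb t0 ttau g0tau)).
  rewrite EFinM -muleA; apply: lee_wpmul2l; first by rewrite lee_fin ltW.
  apply: le_trans (zmax _ Ex); apply: lee_wpmul2l; first by rewrite lee_fin powR_ge0.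
  by rewrite -[in leRHS]Lnorm_abse.
- have mkx : measurable_fun setT (k x) by exact: (measurable_kernel_row rk).
  (* Absolute values go inside for [fin] and [loc x] only, where [|fin + loc x|] is exactly
     [(phi - b)^+ + G]; the signed potential of [rem x] is bounded by [w]. *)
  have -> : potential mu k f x =
      \int[mu]_y (k x y * (fin y + loc x y) + k x y * rem x y)%:E.
    by apply: eq_integral => y _; rewrite -mulrDr -split_f.
  apply: (le_trans (abse_integral_add _ _ _)).
  + by apply: measurable_funM => //; exact: measurable_funD.
  + exact: measurable_funM.
  apply: leeD; last by apply: contrapT => hw; apply: Nx; apply: hN => /= H; apply: hw; exact: H.
  rewrite le_eqVlt; apply/orP; left; apply/eqP; apply: eq_integral => y _.
  rewrite normrM; congr (_ * _)%:E.
  have [Fy|Fy] := pselect (F y).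
    rewrite GT// locT// addr0 -/(phi y).
    by case: (leP (phi y) b) => pb;
      [rewrite max_r ?add0r// subr_le0|rewrite max_l ?subrK// subr_ge0 ltW].
  rewrite GN// /phi finN// add0r normr0 max_r ?add0r//.
  by rewrite oppr_le0.
Qed.

End localized_potential.

(** * Choice of the constant and of the point of [E] *)

Theorem lemma1 (R : realType) (beta A0 Ainf B : R) :
  (1 < beta)%R -> (0 < A0)%R -> (0 < Ainf)%R ->
  (2 `^ (conjugate_exponent beta)^-1 <= B)%R ->
  exists C0 : R,
  [/\ (0 < C0)%R,
      oneil_constant beta A0 Ainf B C0 &
      forall (d : measure_display) (M : borelMetricType R d)
        (mu : {measure set M -> \bar R}) (k : M -> M -> R),
      standing mu -> riesz_like mu beta k A0 Ainf B ->
      forall (f : M -> R) (tau : R),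
      measurable_fun [set: M] f -> ball_supported f ->
      'N[mu]_((conjugate_exponent beta)%:E)[EFin \o f] <= 1 ->
      (0 < tau)%R -> tau%:E < mu [set: M] ->
      forall F E : set M,
      level_set mu (EFin \o f) tau F ->
      level_set mu (potential mu k f) tau E ->
      exists2 z : M, E z &
      forall t : R, (0 < t)%R -> (t <= tau)%R ->
        rearr mu (potential mu k f) t <= rearr_avg mu (potential mu k f) t /\
        rearr_avg mu (potential mu k f) t <=
          oneil mu beta k C0 (f \* \1_F)%R t +
          B%:E * 'N[mu]_((conjugate_exponent beta)%:E)
                   [EFin \o (f \* \1_(~` F) \* \1_(volball mu z tau))%R] +
          potential_circ mu k f F E tau].
Proof.
move=> beta1 _ _ B2; set q := conjugate_exponent beta.
have B0 : (0 < B)%R by apply: lt_le_trans B2; rewrite powR_gt0.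
have q0 : (0 < q)%R by exact: lt_trans (conjugate_exponent_gt1 beta1).
exists (B * q ^+ 2)%R; split; first by rewrite mulr_gt0// exprn_gt0.
- move=> d M mu k st rk h mh _ t t0; exact: (oneil_inequality beta1 B0 st rk).
- move=> d M mu k st rk f tau mf _ f1 tau0 _ F E hF hE.
  have E0 : E !=set0.
    apply/set0P; apply/negP => /eqP E0; case: hE => _ + _ _.
    by rewrite E0 measure0 => -[] /esym/eqP; rewrite gt_eqF.
  (* Since [ln 2 < 1], the tail factor is strictly below 1, which leaves room for an almost
     maximizer of the local norms. *)
  have ln01 : (0 <= ln (2 : R) `^ beta^-1 < 1)%R.
    rewrite powR_ge0/=; have e1 : (1 `^ beta^-1 = 1 :> R)%R by rewrite powR1.
    rewrite -[X in (_ < X)%R]e1.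
    apply: gt0_ltr_powR; rewrite ?nnegrE ?ln_ge0 ?ln2_lt1 ?ler1n//.
    by rewrite invr_gt0 (lt_trans ltr01).
  (* These norms do not involve [t], so one [z] serves every [t <= tau]. *)
  have [|z Ez zmax] := almost_maximizer E0 ln01 (N := fun x =>
      'N[mu]_q%:E[EFin \o (f \* \1_(~` F) \* \1_(volball mu x tau))%R]).
    by move=> x; rewrite Lnorm_ge0/=; exact: (Lnorm_localized_le1 beta1).
  exists z => // t t0 ttau; split; first exact: rearr_le_rearr_avg.
  exact: (rearr_avg_potential_le beta1 B0 st rk).
Qed.
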